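(* In the setting described in the context, let $h$ denote the (random) channel of the single-antenna ($N_t=N_r=1$) system and let $\mathcal{M}(\mathsf{SNR})=C_{N_t,N_r}(\mathsf{SNR})/C_{1,1}(\mathsf{SNR})$ be the finite-SNR multiplexing gain. Then for any $\alpha\in[0,1]$, $$\frac{\mathbb{E}\{\|\mathbf{H}\|_F^2\}}{N_t\,\mathbb{E}\{|h|^2\}}\le\lim_{\mathsf{SNR}\to0}\mathcal{M}(\mathsf{SNR})\le\frac{\mathbb{E}\{\|\mathbf{H}\|_2^2\}}{\mathbb{E}\{|h|^2\}},$$ $$M\le\lim_{\mathsf{SNR}\to\infty}\mathcal{M}(\mathsf{SNR})\le M\,\frac{\log_2(1+\frac{N_t}{M\kappa^2})}{\log_2(1+\frac1{\kappa^2})},$$ where $M=\min(N_t,N_r)$, $\|\cdot\|_F$ is the Frobenius norm and $\|\cdot\|_2$ the spectral norm. The upper bounds are achieved for deterministic channels (with full rank and $\alpha=1$). The lower bounds are achieved for right-rotationally invariant channel distributions (i.e., $\mathbb{H}$ and $\mathbb{H}\mathbf{U}$ equal in distribution for every unitary $\mathbf{U}$).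
   Context: Setting (MIMO channel with transmitter impairments). Let $N_t,N_r\ge1$, $\mathsf{SNR}>0$. The received signal is $\mathbf{y}=\sqrt{\mathsf{SNR}}\,\mathbf{H}(\mathbf{x}+\boldsymbol{\eta}_t)+\mathbf{n}\in\mathbb{C}^{N_r}$, where $\mathbf{x}\in\mathbb{C}^{N_t}$ has covariance $\mathbf{Q}=\mathbb{E}\{\mathbf{x}\mathbf{x}^H\}$ with $\mathrm{tr}(\mathbf{Q})=1$; $\mathbf{n}\sim\mathcal{CN}(\mathbf{0},\mathbf{I})$; the channel $\mathbf{H}\in\mathbb{C}^{N_r\times N_t}$ is a random matrix $\mathbb{H}$ with distribution $f_{\mathbb{H}}$ satisfying $\mathbb{E}\{\mathrm{tr}(\mathbf{H}^H\mathbf{H})\}=N_tN_r$ and $\mathrm{rank}(\mathbf{H})=\min(N_t,N_r)$ almost surely (a deterministic channel is the special case of a point-mass distribution). The distortion $\boldsymbol{\eta}_t\sim\mathcal{CN}(\mathbf{0},\boldsymbol{\Upsilon}_t(\mathbf{Q}))$ is independent of $\mathbf{x},\mathbf{n},\mathbf{H}$, with $\boldsymbol{\Upsilon}_t(\mathbf{Q})=\mathrm{diag}(\upsilon_1(q_1),\dots,\upsilon_{N_t}(q_{N_t}))$, $q_n=[\mathbf{Q}]_{nn}$, $\upsilon_n(q_n)=\kappa^2\big((1-\alpha)q_n+\alpha\frac{1}{N_t}\sum_{i}q_i\big)$, $\alpha\in[0,1]$, $\kappa>0$ (the same $\kappa$ is used for the single-antenna system). The receiver knows the realization $\mathbf{H}$,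 the transmitter only $f_{\mathbb{H}}$. Capacity: $C_{N_t,N_r}(\mathsf{SNR})=\sup_{f_{\mathbb{X}}:\ \mathrm{tr}(\mathbb{E}\{\mathbf{x}\mathbf{x}^H\})=1}\mathbb{E}_{\mathbf{H}}\{\mathcal{I}(\mathbf{x};\mathbf{y}\mid\mathbb{H}=\mathbf{H})\}$, which equals $\sup_{\mathbf{Q}\succeq\mathbf{0},\,\mathrm{tr}(\mathbf{Q})=1}\mathbb{E}_{\mathbf{H}}\{\log_2\det(\mathbf{I}+\mathsf{SNR}\,\mathbf{H}\mathbf{Q}\mathbf{H}^H(\mathsf{SNR}\,\mathbf{H}\boldsymbol{\Upsilon}_t(\mathbf{Q})\mathbf{H}^H+\mathbf{I})^{-1})\}$; $C_{1,1}$ is the same quantity for $N_t=N_r=1$ with channel $h$. *)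

(* Defs.v *)
From HB Require Import structures.
From mathcomp Require Import all_boot all_order all_algebra.
From mathcomp Require Import all_classical all_reals all_analysis.
From mathcomp Require Import complex.
Set Implicit Arguments. Unset Strict Implicit. Unset Printing Implicit Defensive.
Import Order.TTheory GRing.Theory Num.Theory.
Import numFieldNormedType.Exports.
Local Open Scope classical_set_scope.
Local Open Scope ring_scope.

Section MIMO.
Variable R : realType.
Local Notation C := R[i].

Definition hermT m n (A : 'M[C]_(m, n)) : 'M[C]_(n, m) :=
  (map_mx (@conjc R) A)^T.

Definition abs2 (z : C) : R := (complex.Re z) ^+ 2 + (complex.Im z) ^+ 2.

Definition vnorm2 n (v : 'cV[C]_n) : R := \sum_(i < n) abs2 (v i 0).

Definition frob2 m n (A : 'M[C]_(m, n)) : R :=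
  \sum_(i < m) \sum_(j < n) abs2 (A i j).

Definition spec2 m n (A : 'M[C]_(m, n)) : R :=
  sup [set vnorm2 (A *m x) | x in [set x : 'cV[C]_n | vnorm2 x = 1]].

Definition psd n (Q : 'M[C]_n) : Prop :=
  hermT Q = Q /\ forall v : 'cV[C]_n, 0 <= complex.Re ((hermT v *m Q *m v) 0 0).

Definition admissible n (Q : 'M[C]_n) : Prop := psd Q /\ \tr Q = 1.

Definition Upsilon n (kappa alpha : R) (Q : 'M[C]_n) : 'M[C]_n :=
  diag_mx (\row_(k < n)
    ((kappa ^+ 2 * ((1 - alpha) * complex.Re (Q k k)
        + alpha * (n%:R)^-1 * \sum_(i < n) complex.Re (Q i i)))%:C)%C).

Definition log2 (x : R) : R := ln x / ln 2.

Definition rate nr nt (kappa alpha snr : R) (Q : 'M[C]_nt)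
    (H : 'M[C]_(nr, nt)) : R :=
  log2 (complex.Re (\det (1%:M + (snr%:C)%C *: (H *m Q *m hermT H)
     *m invmx ((snr%:C)%C *: (H *m Upsilon kappa alpha Q *m hermT H) + 1%:M)))).

Definition capacity d (T : measurableType d) (P : probability T R) nr nt
    (H : T -> 'M[C]_(nr, nt)) (kappa alpha snr : R) : \bar R :=
  ereal_sup [set (\int[P]_w (rate kappa alpha snr Q (H w))%:E)%E
             | Q in [set Q : 'M[C]_nt | admissible Q]].

Definition expect d (T : measurableType d) (P : probability T R) nr nt
    (H : T -> 'M[C]_(nr, nt)) (f : 'M[C]_(nr, nt) -> R) : \bar R :=
  (\int[P]_w (f (H w))%:E)%E.

Definition channel_ok d (T : measurableType d) (P : probability T R) nr nt
    (H : T -> 'M[C]_(nr, nt)) : Prop :=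
  [/\ (forall i j, measurable_fun setT (fun w => complex.Re (H w i j))),
      (forall i j, measurable_fun setT (fun w => complex.Im (H w i j))),
      expect P H (fun A => complex.Re (\tr (hermT A *m A))) = (nt * nr)%:R%:E &
      {ae P, forall w, \rank (H w) = minn nt nr}].

Definition mx_gen nr nt : set (set 'M[C]_(nr, nt)) :=
  [set A | exists (i : 'I_nr) (j : 'I_nt) (B : set R), measurable B /\
     (A = [set M : 'M[C]_(nr, nt) | B (complex.Re (M i j))] \/ A = [set M : 'M[C]_(nr, nt) | B (complex.Im (M i j))])].

Definition law_eq d (T : measurableType d) (P : probability T R) nr nt
    (H1 H2 : T -> 'M[C]_(nr, nt)) : Prop :=
  forall A, <<s (@mx_gen nr nt) >> A -> P (H1 @^-1` A) = P (H2 @^-1` A).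

Definition unitary n (U : 'M[C]_n) : Prop := U *m hermT U = 1%:M.

Definition right_rot_inv d (T : measurableType d) (P : probability T R) nr nt
    (H : T -> 'M[C]_(nr, nt)) : Prop :=
  forall U : 'M[C]_nt, unitary U -> law_eq P H (fun w => H w *m U).

Definition deterministic d (T : measurableType d) (P : probability T R) nr nt
    (H : T -> 'M[C]_(nr, nt)) : Prop :=
  exists H0, {ae P, forall w, H w = H0}.

Definition mux_gain d (T : measurableType d) (P : probability T R) nr nt
    (H : T -> 'M[C]_(nr, nt)) d1 (T1 : measurableType d1)
    (P1 : probability T1 R) (h : T1 -> 'M[C]_(1, 1)) (kappa alpha snr : R) : R :=
  fine (capacity P H kappa alpha snr) / fine (capacity P1 h kappa alpha snr).

End MIMO.

(* Main.v *)
Require Import Defs.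
From HB Require Import structures.
From mathcomp Require Import all_boot all_order all_algebra.
From mathcomp Require Import all_classical all_reals all_analysis.
From mathcomp Require Import complex spectral sesquilinear fingroup perm measurable_realfun.
From mathcomp Require Import ring lra.
Import Order.TTheory GRing.Theory Num.Theory.
Import numFieldNormedType.Exports.
Local Open Scope classical_set_scope.
Local Open Scope complex_scope.
Local Open Scope ring_scope.

(** Write [gmi s H X = ln det (I + s H X H^H)], so that the rate of an input
    covariance [Q] with distortion covariance [Y] is, up to the factor [ln 2],
    [gmi s H (Q + Y) - gmi s H Y].

    Low SNR: the concavity of [ln det] squeezes this difference between
    [s w / (1 + s O(1))] and [s w] with [w = tr (H Q H^H)], so the capacity
    divided by [s] tends to [lam / ln 2] for [lam] the supremum over [Q] of
    [E tr (H Q H^H)], which lies between the isotropic value [E |H|_F^2 / Nt] and [E |H|_2^2].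

    High SNR: the difference is nondecreasing in [s], so the capacity converges
    to its supremum.  A rank factorization [H = L K] replaces the noise
    covariance by a positive definite matrix of size [rank H = M]; then the
    tangent inequality for [ln det] at [(1 + t)] times the noise-plus-distortion
    covariance, together with [tr (P^-1 s K Q K^H) <= sum_k q_k / u_k], where
    [u_k] are the distortion powers and the sum is at most [Nt / kappa^2], gives
    the upper bound, and [Q = I / Nt] the lower one.

    Right-rotational invariance: [X |-> E (gmi s H X)] is concave and invariant
    under unitary conjugation, and [(1 + 1/kappa^2) Y] is an average of unitary
    conjugates of [Q + Y].  The single-antenna system is the case
    [Nt = Nr = 1], where both bounds coincide. *)

Set Implicit Arguments.
Unset Strict Implicit.
Unset Printing Implicit Defensive.

(** * Positive semidefinite matrices and inequalities for the log-determinant *)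

Section HermitianMatrices.
Variable R : realType.
Local Notation C := R[i].
Local Notation re := (@complex.Re R).

(** For a positive semidefinite matrix, invertibility is equivalent to strict positivity of the
    quadratic form, and it passes easily through products and determinants. *)
Definition pd n (X : 'M[C]_n) := psd X /\ X \in unitmx.

(** On positive definite matrices the determinant is real and positive, so the real part loses
    nothing there. *)
Definition ldet n (X : 'M[C]_n) : R := ln (re (\det X)).

Definition rdiag n (d : 'I_n -> R) : 'M[C]_n := diag_mx (\row_i (d i)%:C).

Lemma reD (x y : C) : re (x + y) = re x + re y.
Proof. by case: x; case: y. Qed.

Lemma reB (x y : C) : re (x - y) = re x - re y.
Proof. by case: x; case: y. Qed.

Lemma reZ (a : R) (x : C) : re (a%:C * x) = a * re x.
Proof. by case: x => u v /=; rewrite mul0r subr0. Qed.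

Lemma re_sum (I : Type) (r : seq I) (p : pred I) (F : I -> C) :
  re (\sum_(i <- r | p i) F i) = \sum_(i <- r | p i) re (F i).
Proof.
elim/big_rec2: _ => [//|i x y _ <-]; exact: reD.
Qed.

Lemma mul_conjc (z : C) : z * conjc z = (abs2 z)%:C.
Proof.
by case: z => a b; rewrite /abs2 /=; apply/eqP; rewrite eq_complex /=;
  apply/andP; split; apply/eqP; ring.
Qed.

Lemma abs2_ge0 (z : C) : 0 <= abs2 z.
Proof. by rewrite /abs2 addr_ge0// sqr_ge0. Qed.

Lemma abs2_eq0 (z : C) : abs2 z = 0 -> z = 0.
Proof.
case: z => a b; rewrite /abs2/= => /eqP.
by rewrite paddr_eq0 ?sqr_ge0// !sqrf_eq0 => /andP[/eqP -> /eqP ->].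
Qed.

Lemma hermTE m n (A : 'M[C]_(m, n)) i j : hermT A i j = conjc (A j i).
Proof. by rewrite !mxE. Qed.

Lemma hermTK m n (A : 'M[C]_(m, n)) : hermT (hermT A) = A.
Proof. by apply/matrixP => i j; rewrite !hermTE conjcK. Qed.

Lemma hermT_mul m n p (A : 'M[C]_(m, n)) (B : 'M[C]_(n, p)) :
  hermT (A *m B) = hermT B *m hermT A.
Proof. by rewrite /hermT map_mxM trmx_mul. Qed.

Lemma hermTD m n (A B : 'M[C]_(m, n)) : hermT (A + B) = hermT A + hermT B.
Proof. by rewrite /hermT map_mxD linearD. Qed.

Lemma hermTZ m n (c : R) (A : 'M[C]_(m, n)) :
  hermT (c%:C *: A) = c%:C *: hermT A.
Proof. by rewrite /hermT map_mxZ linearZ /= oppr0. Qed.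

Lemma hermT1 n : hermT (1%:M : 'M[C]_n) = 1%:M.
Proof. by rewrite /hermT map_mx1 trmx1. Qed.

Lemma hermT_unit n (A : 'M[C]_n) : (hermT A \in unitmx) = (A \in unitmx).
Proof. by rewrite /hermT unitmx_tr map_unitmx. Qed.

Lemma hermT_inv n (A : 'M[C]_n) : hermT (invmx A) = invmx (hermT A).
Proof. by rewrite /hermT map_invmx trmx_inv. Qed.

Lemma det_hermT n (A : 'M[C]_n) : \det (hermT A) = conjc (\det A).
Proof. by rewrite /hermT det_tr det_map_mx. Qed.

Lemma hermT_rdiag n (d : 'I_n -> R) : hermT (rdiag d) = rdiag d.
Proof.
apply/matrixP => i j; rewrite !mxE.
rewrite eq_sym; case: eqVneq => [->|ne]; rewrite ?mulr1n ?mulr0n ?conjc0//.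
exact: conjc_real.
Qed.

Lemma mulmx_rdiag n (d e : 'I_n -> R) :
  rdiag d *m rdiag e = rdiag (fun i => d i * e i).
Proof.
rewrite /rdiag mulmx_diag; congr diag_mx; apply/rowP => i.
by rewrite !mxE rmorphM.
Qed.

Lemma rdiagD n (d e : 'I_n -> R) : rdiag d + rdiag e = rdiag (fun i => d i + e i).
Proof. by apply/matrixP => i j; rewrite !mxE rmorphD mulrnDl. Qed.

Lemma rdiagB n (d e : 'I_n -> R) : rdiag d - rdiag e = rdiag (fun i => d i - e i).
Proof. by apply/matrixP => i j; rewrite !mxE rmorphB mulrnBl. Qed.

Lemma rdiag1 n : rdiag (fun _ : 'I_n => 1) = 1%:M.
Proof. by apply/matrixP => i j; rewrite !mxE. Qed.

Lemma tr_rdiag n (d : 'I_n -> R) : \tr (rdiag d) = (\sum_i d i)%:C.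
Proof.
rewrite mxtrace_diag rmorph_sum; apply: eq_bigr => i _; by rewrite mxE.
Qed.

Lemma det_rdiag n (d : 'I_n -> R) : \det (rdiag d) = (\prod_i d i)%:C.
Proof.
rewrite det_diag rmorph_prod; apply: eq_bigr => i _; by rewrite mxE.
Qed.

Lemma tr_mul_hermT m n (A : 'M[C]_(m, n)) : \tr (A *m hermT A) = (frob2 A)%:C.
Proof.
rewrite /frob2 rmorph_sum; apply: eq_bigr => i _.
rewrite mxE rmorph_sum; apply: eq_bigr => j _.
by rewrite hermTE mul_conjc.
Qed.

Lemma frob2_ge0 m n (A : 'M[C]_(m, n)) : 0 <= frob2 A.
Proof. by do 2 (apply: sumr_ge0 => ? _); exact: abs2_ge0. Qed.

Lemma vnorm2E n (v : 'cV[C]_n) : (hermT v *m v) 0 0 = (vnorm2 v)%:C.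
Proof.
rewrite mxE rmorph_sum; apply: eq_bigr => i _.
by rewrite hermTE mulrC mul_conjc.
Qed.

Lemma vnorm2_ge0 n (v : 'cV[C]_n) : 0 <= vnorm2 v.
Proof. by apply: sumr_ge0 => ? _; exact: abs2_ge0. Qed.

Lemma psd_gram m n (S : 'M[C]_(n, m)) : psd (S *m hermT S).
Proof.
split; first by rewrite hermT_mul hermTK.
move=> v; set w := hermT S *m v.
have -> : hermT v *m (S *m hermT S) *m v = hermT w *m w.
  by rewrite /w hermT_mul hermTK !mulmxA.
by rewrite vnorm2E /= vnorm2_ge0.
Qed.

Lemma psd_congr m n (A : 'M[C]_(m, n)) (X : 'M[C]_n) :
  psd X -> psd (A *m X *m hermT A).
Proof.
move=> [hX pX]; split; first by rewrite !hermT_mul hermTK hX mulmxA.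
by move=> v; have := pX (hermT A *m v); rewrite hermT_mul hermTK !mulmxA.
Qed.

Lemma psdD n (X Y : 'M[C]_n) : psd X -> psd Y -> psd (X + Y).
Proof.
move=> [hX pX] [hY pY]; split; first by rewrite hermTD hX hY.
by move=> v; rewrite mulmxDr mulmxDl mxE reD addr_ge0.
Qed.

Lemma psdZ n (c : R) (X : 'M[C]_n) : 0 <= c -> psd X -> psd (c%:C *: X).
Proof.
move=> c0 [hX pX]; split; first by rewrite hermTZ hX.
by move=> v; rewrite -scalemxAr -scalemxAl mxE reZ mulr_ge0.
Qed.

Lemma psd_rdiag n (d : 'I_n -> R) : (forall i, 0 <= d i) -> psd (rdiag d).
Proof.
move=> d0; have -> : rdiag d = rdiag (fun i => Num.sqrt (d i))
    *m hermT (rdiag (fun i => Num.sqrt (d i))).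
  rewrite hermT_rdiag mulmx_rdiag; congr rdiag; apply/funext => i.
  by rewrite -expr2 sqr_sqrtr.
exact: psd_gram.
Qed.

Lemma psd1 n : psd (1%:M : 'M[C]_n).
Proof. by rewrite -rdiag1; apply: psd_rdiag => i; exact: ler01. Qed.

Lemma psd0 n : psd (0 : 'M[C]_n).
Proof. by rewrite -[0](@mul0mx _ _ n _ (hermT 0)); exact: psd_gram. Qed.

(** A Hermitian matrix is normal, so the spectral theorem applies; the diagonal factor [U X U^H] is
    again Hermitian, which makes the eigenvalues real. *)
Lemma spectral_herm n (X : 'M[C]_n) : hermT X = X ->
  exists U d, unitary (U : 'M[C]_n) /\ X = hermT U *m rdiag d *m U.
Proof.
move=> hX; case: n X hX => [|n] X hX.
  exists 0, (fun=> 0); split; first by apply/matrixP; case.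
  by apply/matrixP; case.
have ctE m p (A : 'M[C]_(m, p)) : map_mx Num.conj A^T = hermT A.
  by apply/matrixP => i j; rewrite !mxE.
have nX : X \is normalmx by apply/normalmxP; rewrite ctE hX.
have /orthomx_spectralP := nX.
set U := spectralmx X => eX.
have uU : U \is unitarymx by exact: spectral_unitarymx.
have UU : unitary U by rewrite /unitary -ctE; apply/unitarymxP.
have iU : invmx U = hermT U by rewrite invmx_unitary// ctE.
rewrite iU in eX.
have dE : diag_mx (spectral_diag X) = U *m X *m hermT U.
  rewrite [in RHS]eX !mulmxA UU mul1mx -mulmxA UU mulmx1 //.
have hd : hermT (diag_mx (spectral_diag X)) = diag_mx (spectral_diag X).
  by rewrite dE !hermT_mul hermTK hX mulmxA.
exists U; exists (fun i => re (spectral_diag X 0 i)); split; first exact: UU.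
rewrite {1}eX; congr (_ *m _ *m _); congr diag_mx; apply/rowP => i.
rewrite !mxE; have := congr1 (fun M : 'M[C]_n.+1 => M i i) hd.
rewrite hermTE !mxE eqxx /= !mulr1n; case: (spectral_diag X 0 i) => a b [/= h].
by apply/eqP; rewrite eq_complex /= eqxx /=; apply/eqP; lra.
Qed.

Lemma unitaryC n (U : 'M[C]_n) : unitary U -> hermT U *m U = 1%:M.
Proof. by move/mulmx1C. Qed.

Lemma spectral_psd n (X : 'M[C]_n) : psd X ->
  exists U d, [/\ unitary (U : 'M[C]_n), X = hermT U *m rdiag d *m U &
    forall i, 0 <= d i].
Proof.
move=> pX; have [U [d [uU eX]]] := spectral_herm pX.1.
exists U, d; split=> // i.
have dE : rdiag d = U *m X *m hermT U.
  by rewrite eX !mulmxA uU mul1mx -mulmxA uU mulmx1.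
set v : 'cV[C]_n := delta_mx i 0.
have := (psd_congr U pX).2 v; rewrite -dE.
have -> : (hermT v *m rdiag d *m v) 0 0 = (d i)%:C.
  have -> : hermT v = delta_mx 0 i.
    by apply/matrixP => a b; rewrite hermTE !mxE andbC; exact: conjc_nat.
  by rewrite -rowE -colE !mxE eqxx mulr1n.
by [].
Qed.

Lemma psd_fact n (X : 'M[C]_n) : psd X -> exists S : 'M[C]_n, X = S *m hermT S.
Proof.
move=> /spectral_psd[U [d [uU -> d0]]].
exists (hermT U *m rdiag (fun i => Num.sqrt (d i))).
rewrite hermT_mul hermTK hermT_rdiag mulmxA; congr (_ *m _).
rewrite -mulmxA mulmx_rdiag; congr (_ *m _); congr rdiag; apply/funext => i.
by rewrite -expr2 sqr_sqrtr.
Qed.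

(** With [X = S S^H] and [Y = T T^H] the trace is the squared Frobenius norm of [S^H T]. *)
Lemma psd_tr_mul_ge0 n (X Y : 'M[C]_n) : psd X -> psd Y -> 0 <= re (\tr (X *m Y)).
Proof.
move=> /psd_fact[S ->] /psd_fact[T ->].
rewrite -mulmxA mxtrace_mulC.
have -> : hermT S *m (T *m hermT T) *m S
    = (hermT S *m T) *m hermT (hermT S *m T).
  by rewrite hermT_mul hermTK !mulmxA.
by rewrite tr_mul_hermT /= frob2_ge0.
Qed.

Lemma psd_tr_ge0 n (X : 'M[C]_n) : psd X -> 0 <= re (\tr X).
Proof. by move=> pX; have := psd_tr_mul_ge0 (psd1 n) pX; rewrite mul1mx. Qed.

Lemma psd_diag_ge0 n (X : 'M[C]_n) k : psd X -> 0 <= re (X k k).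
Proof.
move=> /psd_fact[S ->]; rewrite mxE re_sum; apply: sumr_ge0 => j _.
by rewrite hermTE mul_conjc /= abs2_ge0.
Qed.

(** With [X = S S^H], the diagonal entry is the squared norm of row [k] of [S], so that row
    vanishes. *)
Lemma psd_diag_eq0 n (X : 'M[C]_n) k : psd X -> re (X k k) = 0 ->
  forall j, X k j = 0 /\ X j k = 0.
Proof.
move=> /psd_fact[S ->]; rewrite mxE re_sum => h.
have S0 j : S k j = 0.
  apply: abs2_eq0; move/eqP: h; rewrite psumr_eq0; last first.
    by move=> i _; rewrite hermTE mul_conjc /= abs2_ge0.
  by move=> /allP /(_ j (mem_index_enum _)) /=; rewrite hermTE mul_conjc /= => /eqP.
move=> j; rewrite !mxE; split; apply: big1 => i _; rewrite hermTE S0 ?mul0r//.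
by rewrite conjc0 mulr0.
Qed.

Lemma pd1 n : pd (1%:M : 'M[C]_n).
Proof. by split; [exact: psd1 | exact: unitmx1]. Qed.

Lemma pd_fact n (Y : 'M[C]_n) : pd Y ->
  exists S : 'M[C]_n, S \in unitmx /\ Y = S *m hermT S.
Proof.
move=> [/psd_fact[S ->]]; rewrite unitmx_mul => /andP[uS _].
by exists S.
Qed.

(** Write [Y = S S^H], diagonalize [S^-1 X S^-H] as [U^H D U] and take [T = S U^H]. Matrix
    inequalities between [X] and [Y] then become scalar ones in the [d i]. *)
Lemma simul_diag n (Y X : 'M[C]_n) : pd Y -> psd X ->
  exists T d, [/\ (T : 'M[C]_n) \in unitmx, Y = T *m hermT T,
    X = T *m rdiag d *m hermT T & forall i, 0 <= d i].
Proof.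
move=> /pd_fact[S [uS ->]] pX.
have [U [d [uU eX d0]]] := spectral_psd (psd_congr (invmx S) pX).
have uUm : U \in unitmx by have [] := mulmx1_unit uU.
exists (S *m hermT U), d; split=> //.
- by rewrite unitmx_mul uS hermT_unit.
- by rewrite hermT_mul hermTK -mulmxA [_ *m (U *m _)]mulmxA unitaryC// mul1mx.
- rewrite hermT_mul hermTK.
  have -> : S *m hermT U *m rdiag d *m (U *m hermT S)
    = S *m (hermT U *m rdiag d *m U) *m hermT S by rewrite !mulmxA.
  rewrite -eX hermT_inv !mulmxA mulmxV// mul1mx mulmxKV// hermT_unit//.
Qed.

Lemma pd_congr_rdiag n (T : 'M[C]_n) (d : 'I_n -> R) : T \in unitmx ->
  (forall i, 0 < d i) -> pd (T *m rdiag d *m hermT T).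
Proof.
move=> uT d0; split.
  by apply: psd_congr; apply: psd_rdiag => i; exact: ltW.
rewrite !unitmx_mul uT hermT_unit uT andbT /= unitmxE det_rdiag unitfE.
rewrite (inj_eq (@complexI R)) gt_eqF//; exact: prodr_gt0.
Qed.

Lemma invmx_congr_rdiag n (T : 'M[C]_n) (d : 'I_n -> R) : T \in unitmx ->
  (forall i, 0 < d i) -> invmx (T *m rdiag d *m hermT T)
    = hermT (invmx T) *m rdiag (fun i => (d i)^-1) *m invmx T.
Proof.
move=> uT d0; have [_ uX] := pd_congr_rdiag uT d0.
apply: (can_inj (mulKmx uX)); rewrite mulmxV//.
have uTh : hermT T \in unitmx by rewrite hermT_unit.
rewrite hermT_inv -!mulmxA [hermT T *m _]mulmxA mulmxV// mul1mx.
rewrite [rdiag d *m _]mulmxA mulmx_rdiag.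
have -> : (fun i => d i * (d i)^-1) = (fun=> 1).
  by apply/funext => i; rewrite divff// gt_eqF.
by rewrite rdiag1 mul1mx mulmxV.
Qed.

Lemma det_congr_rdiag n (T : 'M[C]_n) (d : 'I_n -> R) :
  \det (T *m rdiag d *m hermT T) = (abs2 (\det T) * \prod_i d i)%:C.
Proof.
by rewrite !det_mulmx det_hermT det_rdiag mulrAC mul_conjc rmorphM.
Qed.

Lemma abs2_det_gt0 n (T : 'M[C]_n) : T \in unitmx -> 0 < abs2 (\det T).
Proof.
rewrite unitmxE unitfE => h; rewrite lt_neqAle abs2_ge0 andbT eq_sym.
by apply: contra_neq h; exact: abs2_eq0.
Qed.

Lemma ln_prod n (d : 'I_n -> R) : (forall i, 0 < d i) ->
  ln (\prod_i d i) = \sum_i ln (d i).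
Proof.
move=> d0; suff [] : 0 < \prod_i d i /\ ln (\prod_i d i) = \sum_i ln (d i) by [].
elim/big_rec2: _ => [|i x y _ [y0 <-]]; first by rewrite ln1.
by rewrite mulr_gt0// lnM// posrE.
Qed.

Lemma ldet_congr_rdiag n (T : 'M[C]_n) (d : 'I_n -> R) : T \in unitmx ->
  (forall i, 0 < d i) ->
  ldet (T *m rdiag d *m hermT T) = ln (abs2 (\det T)) + \sum_i ln (d i).
Proof.
move=> uT d0; rewrite /ldet det_congr_rdiag /= lnM ?posrE ?abs2_det_gt0//.
  by rewrite ln_prod.
exact: prodr_gt0.
Qed.

Lemma pd_det n (X : 'M[C]_n) : pd X -> exists2 x : R, 0 < x & \det X = x%:C.
Proof.
move=> /pd_fact[T [uT ->]]; exists (abs2 (\det T)); first exact: abs2_det_gt0.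
by rewrite det_mulmx det_hermT mul_conjc.
Qed.

Lemma re_det_gt0 n (X : 'M[C]_n) : pd X -> 0 < re (\det X).
Proof. by move=> /pd_det[x x0 ->]. Qed.

Lemma pd_addr n (X Y : 'M[C]_n) : pd X -> psd Y -> pd (X + Y).
Proof.
move=> pX pY; have [T [d [uT -> -> d0]]] := simul_diag pX pY.
rewrite -[X in X *m hermT T + _]mulmx1 -rdiag1 -mulmxDl -mulmxDr rdiagD.
by apply: pd_congr_rdiag => // i; rewrite ltr_pwDl.
Qed.

Lemma pdZ n (c : R) (X : 'M[C]_n) : 0 < c -> pd X -> pd (c%:C *: X).
Proof.
move=> c0 [pX uX]; split; first by apply: psdZ => //; exact: ltW.
by rewrite unitmxZ// unitfE (inj_eq (@complexI R)) gt_eqF.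
Qed.

Lemma pd_inv n (X : 'M[C]_n) : pd X -> pd (invmx X).
Proof.
move=> [[hX pX] uX]; split; last by rewrite unitmx_inv.
have -> : invmx X = invmx X *m X *m hermT (invmx X).
  by rewrite hermT_inv hX mulVmx// mul1mx.
by apply: psd_congr.
Qed.

Lemma ldetZ n (c : R) (X : 'M[C]_n) : 0 < c -> pd X ->
  ldet (c%:C *: X) = n%:R * ln c + ldet X.
Proof.
move=> c0 pX; rewrite /ldet detZ -rmorphXn reZ lnM ?posrE ?exprn_gt0 ?re_det_gt0//.
by rewrite lnXn// mulr_natl.
Qed.

(** Concavity of the log-determinant in tangent form. In a basis where [Y] is the identity and [X]
    is diagonal it is [ln d_i <= d_i - 1], summed over [i]. *)
Lemma tangent n (X Y : 'M[C]_n) : pd X -> pd Y ->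
  ldet X <= ldet Y + re (\tr (invmx Y *m (X - Y))).
Proof.
move=> pX pY; have [T [d [uT eY eX d0]]] := simul_diag pY pX.1.
have dp i : 0 < d i.
  rewrite lt_neqAle d0 andbT eq_sym; apply/negP => /eqP di.
  have [_] := pX; rewrite unitmxE unitfE eX det_congr_rdiag.
  by rewrite (bigD1 i)//= di mul0r mulr0 eqxx.
rewrite eX ldet_congr_rdiag// eY.
have -> : T *m hermT T = T *m rdiag (fun=> 1) *m hermT T by rewrite rdiag1 mulmx1.
rewrite ldet_congr_rdiag// invmx_congr_rdiag//.
rewrite -mulmxBl -mulmxBr rdiagB.
have -> : (fun _ : 'I_n => (1 : R)^-1) = (fun=> 1) by apply/funext => i; rewrite invr1.
rewrite rdiag1 mulmx1 -!mulmxA mulKmx// mxtrace_mulC -!mulmxA -hermT_mul mulVmx//.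
rewrite hermT1 mulmx1 tr_rdiag /= -addrA lerD2l -big_split /=.
apply: ler_sum => i _; rewrite ln1 add0r.
have := @le_ln1Dx R (d i - 1).
rewrite addrCA subrr addr0; apply; have := dp i; lra.
Qed.

(** The linear term of the tangent at [Y] is [- tr (Y^-1 (Y - X))], which is nonpositive. *)
Lemma ldet_mono n (X Y : 'M[C]_n) : pd X -> psd (Y - X) -> ldet X <= ldet Y.
Proof.
move=> pX h; have pY : pd Y.
  by rewrite -(subrK X Y) addrC; exact: pd_addr.
have := tangent pX pY; have := psd_tr_mul_ge0 (pd_inv pY).1 h.
rewrite -[X - Y]opprB mulmxN linearN /=.
set a := re _; have -> : re (- \tr (invmx Y *m (Y - X))) = - a.
  by rewrite -[- _]add0r reB sub0r.
lra.
Qed.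

(** Diagonalizing [X - Y] relative to [Y] reduces this to [1 / (1 + d_i) <= 1]. *)
Lemma inv_antitone n (X Y : 'M[C]_n) : pd Y -> psd (X - Y) ->
  psd (invmx Y - invmx X).
Proof.
move=> pY h; have [T [d [uT eY eX d0]]] := simul_diag pY h.
have d1 i : 0 < 1 + d i by rewrite ltr_pwDl.
have iX : invmx X = hermT (invmx T) *m rdiag (fun i => (1 + d i)^-1) *m invmx T.
  rewrite -(invmx_congr_rdiag uT d1); congr invmx.
  by rewrite -rdiagD rdiag1 mulmxDr mulmxDl mulmx1 -eY -eX addrC subrK.
have iY : invmx Y = hermT (invmx T) *m rdiag (fun i => 1^-1) *m invmx T.
  rewrite -(invmx_congr_rdiag uT (fun=> ltr01)); congr invmx.
  by rewrite rdiag1 mulmx1.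
rewrite iX iY -mulmxBl -mulmxBr rdiagB -[X in _ *m X]hermTK; apply: psd_congr.
apply: psd_rdiag => i; rewrite invr1 subr_ge0 invf_le1// lerDl.
exact: d0.
Qed.

End HermitianMatrices.

(** * Inequalities for a single channel realization *)

Section ChannelInequalities.
Variable R : realType.
Local Notation C := R[i].
Local Notation re := (@complex.Re R).

(** The noiseless received power, at unit SNR, of an input with covariance [X]. *)
Definition wtr nr nt (H : 'M[C]_(nr, nt)) (X : 'M[C]_nt) : R :=
  re (\tr (H *m X *m hermT H)).

(* The Gaussian mutual information, in nats, of a channel [H] with input
   covariance [X] and no distortion. *)
Definition gmi nr nt (s : R) (H : 'M[C]_(nr, nt)) (X : 'M[C]_nt) : R :=
  ldet (1%:M + s%:C *: (H *m X *m hermT H)).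

Lemma congrD nr nt (H : 'M[C]_(nr, nt)) X Y :
  H *m (X + Y) *m hermT H = H *m X *m hermT H + H *m Y *m hermT H.
Proof. by rewrite mulmxDr mulmxDl. Qed.

Lemma congrZ nr nt (H : 'M[C]_(nr, nt)) c X :
  H *m (c *: X) *m hermT H = c *: (H *m X *m hermT H).
Proof. by rewrite -scalemxAr -scalemxAl. Qed.

Lemma wtrD nr nt (H : 'M[C]_(nr, nt)) X Y : wtr H (X + Y) = wtr H X + wtr H Y.
Proof. by rewrite /wtr congrD linearD reD. Qed.

Lemma wtrZ nr nt (H : 'M[C]_(nr, nt)) (c : R) X :
  wtr H (c%:C *: X) = c * wtr H X.
Proof. by rewrite /wtr congrZ linearZ reZ. Qed.

Lemma wtr_ge0 nr nt (H : 'M[C]_(nr, nt)) X : psd X -> 0 <= wtr H X.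
Proof. by move=> pX; apply: psd_tr_ge0; exact: psd_congr. Qed.

Lemma re_trZ n (c : R) (X : 'M[C]_n) : re (\tr (c%:C *: X)) = c * re (\tr X).
Proof. by rewrite linearZ reZ. Qed.

Lemma re_trD n (X Y : 'M[C]_n) : re (\tr (X + Y)) = re (\tr X) + re (\tr Y).
Proof. by rewrite linearD reD. Qed.

Lemma re_trB n (X Y : 'M[C]_n) : re (\tr (X - Y)) = re (\tr X) - re (\tr Y).
Proof. by rewrite linearB reB. Qed.

(** The eigenvalues of [W] are nonnegative, so none exceeds their sum. *)
Lemma psd_tr_sub n (W : 'M[C]_n) : psd W -> psd ((re (\tr W))%:C *: 1%:M - W).
Proof.
move=> /spectral_psd[U [d [uU -> d0]]].
rewrite mxtrace_mulC mulmxA uU mul1mx tr_rdiag /=.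
have -> : (\sum_i d i)%:C *: 1%:M = hermT U *m rdiag (fun=> \sum_i d i) *m U.
  have -> : rdiag (fun _ : 'I_n => \sum_i d i) = (\sum_i d i)%:C *: 1%:M.
    by apply/matrixP => i j; rewrite !mxE mulr_natr.
  by rewrite -scalemxAr mulmx1 -scalemxAl unitaryC.
rewrite -mulmxBl -mulmxBr rdiagB -{2}[U]hermTK; apply: psd_congr.
apply: psd_rdiag => i; rewrite subr_ge0 (bigD1 i)//= lerDl.
exact: sumr_ge0.
Qed.

Lemma psd_tr_sub1 n (W : 'M[C]_n) : psd W ->
  psd ((1 + re (\tr W))%:C *: 1%:M - (1%:M + W)).
Proof.
move=> /psd_tr_sub; rewrite rmorphD scalerDl scale1r opprD addrACA subrr add0r.
by [].
Qed.

(** [H^H H] is at most [|H|_F^2] times the identity; both sides are paired with [X] under the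
    trace. *)
Lemma wtr_le_frob2 nr nt (H : 'M[C]_(nr, nt)) X : psd X ->
  wtr H X <= re (\tr X) * frob2 H.
Proof.
move=> pX.
have pW : psd (hermT H *m H) by rewrite -{2}[H]hermTK; exact: psd_gram.
have := psd_tr_mul_ge0 (psd_tr_sub pW) pX.
rewrite mulmxBl re_trB -scalemxAl mul1mx re_trZ.
have -> : re (\tr (hermT H *m H)) = frob2 H by rewrite mxtrace_mulC tr_mul_hermT.
have -> : re (\tr (hermT H *m H *m X)) = wtr H X.
  by rewrite /wtr [in RHS]mxtrace_mulC mulmxA.
by rewrite subr_ge0 mulrC.
Qed.

Lemma wtr_vec nr nt (H : 'M[C]_(nr, nt)) (v : 'cV[C]_nt) :
  wtr H (v *m hermT v) = vnorm2 (H *m v).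
Proof.
have -> : wtr H (v *m hermT v) = re (\tr ((H *m v) *m hermT (H *m v))).
  by rewrite /wtr hermT_mul !mulmxA.
by rewrite mxtrace_mulC /mxtrace big_ord1 vnorm2E.
Qed.

Lemma re_tr_vec n (v : 'cV[C]_n) : re (\tr (v *m hermT v)) = vnorm2 v.
Proof. by rewrite mxtrace_mulC /mxtrace big_ord1 vnorm2E. Qed.

Lemma vnorm2Z n (c : R) (v : 'cV[C]_n) : vnorm2 (c%:C *: v) = c ^+ 2 * vnorm2 v.
Proof.
rewrite /vnorm2 mulr_sumr; apply: eq_bigr => i _; rewrite mxE /abs2.
by case: (v i 0) => a b /=; ring.
Qed.

Lemma vnorm2_mulmx_le nr nt (H : 'M[C]_(nr, nt)) v :
  vnorm2 (H *m v) <= frob2 H * vnorm2 v.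
Proof.
rewrite -wtr_vec -re_tr_vec mulrC; apply: wtr_le_frob2; exact: psd_gram.
Qed.

Definition spec_set nr nt (H : 'M[C]_(nr, nt)) : set R :=
  [set vnorm2 (H *m x) | x in [set x : 'cV[C]_nt | vnorm2 x = 1]].

Lemma spec_set_ub nr nt (H : 'M[C]_(nr, nt)) : ubound (spec_set H) (frob2 H).
Proof.
by move=> _ [x /= x1 <-]; have := vnorm2_mulmx_le H x; rewrite x1 mulr1.
Qed.

Lemma spec_set_neq0 nr nt (H : 'M[C]_(nr, nt)) : (0 < nt)%N -> spec_set H !=set0.
Proof.
case: nt H => // n H _; exists (vnorm2 (H *m delta_mx 0 0)).
exists (delta_mx 0 0) => //=; rewrite /vnorm2 (bigD1 0)//= big1; last first.
  by move=> i ne; rewrite !mxE (negbTE ne) /abs2 /= expr0n /= addr0.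
by rewrite !mxE /abs2 /= expr1n expr0n /= !addr0.
Qed.

Lemma has_sup_spec_set nr nt (H : 'M[C]_(nr, nt)) : (0 < nt)%N -> has_sup (spec_set H).
Proof.
by move=> n0; split; [exact: spec_set_neq0 | exists (frob2 H); exact: spec_set_ub].
Qed.

Lemma spec2_le_frob2 nr nt (H : 'M[C]_(nr, nt)) : (0 < nt)%N -> spec2 H <= frob2 H.
Proof. by move=> n0; apply: ge_sup; [exact: spec_set_neq0 | exact: spec_set_ub]. Qed.

Lemma spec2_ge0 nr nt (H : 'M[C]_(nr, nt)) : 0 <= spec2 H.
Proof.
rewrite /spec2 -/(spec_set H); have [h|h] := pselect (has_sup (spec_set H)).
  have [_ [x /= x1 _]] := h.1.
  apply: (le_trans (vnorm2_ge0 (H *m x))); apply: ub_le_sup; first exact: h.2.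
  by exists x.
(* Without unit vectors ([nt = 0]) the supremum takes its default value 0. *)
by rewrite sup_out.
Qed.

Lemma vnorm2_le_spec2 nr nt (H : 'M[C]_(nr, nt)) v :
  vnorm2 (H *m v) <= spec2 H * vnorm2 v.
Proof.
have [v0|v0] := eqVneq (vnorm2 v) 0.
  by have := vnorm2_mulmx_le H v; rewrite v0 !mulr0.
have vp : 0 < vnorm2 v by rewrite lt_neqAle eq_sym v0 vnorm2_ge0.
rewrite -ler_pdivrMr//.
set c := (Num.sqrt (vnorm2 v))^-1.
have c2 : c ^+ 2 = (vnorm2 v)^-1 by rewrite exprVn sqr_sqrtr// ltW.
have -> : vnorm2 (H *m v) / vnorm2 v = vnorm2 (H *m (c%:C *: v)).
  by rewrite -scalemxAr vnorm2Z c2 mulrC.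
apply: ub_le_sup; first by exists (frob2 H); exact: spec_set_ub.
by exists (c%:C *: v) => //=; rewrite vnorm2Z c2 mulVf.
Qed.

Lemma wtr_sum nr nt (I : finType) (H : 'M[C]_(nr, nt)) (F : I -> 'M[C]_nt) :
  wtr H (\sum_i F i) = \sum_i wtr H (F i).
Proof.
elim/big_rec2: _ => [|i x y _ <-]; last by rewrite wtrD.
by rewrite /wtr mulmx0 mul0mx linear0.
Qed.

Lemma mulmx_hermT_sum m n (S : 'M[C]_(m, n)) :
  S *m hermT S = \sum_j col j S *m hermT (col j S).
Proof.
apply/matrixP => i k; rewrite mxE summxE; apply: eq_bigr => j _.
by rewrite [in RHS]mxE big_ord1 !mxE.
Qed.

(** Splitting [X = S S^H] into rank-one terms, one per column of [S], leaves one spectral bound per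
    column. *)
Lemma wtr_le_spec2 nr nt (H : 'M[C]_(nr, nt)) X : psd X ->
  wtr H X <= re (\tr X) * spec2 H.
Proof.
move=> /psd_fact[S ->]; rewrite mulmx_hermT_sum wtr_sum (raddf_sum mxtrace) re_sum.
rewrite mulr_suml; apply: ler_sum => j _.
by rewrite wtr_vec re_tr_vec mulrC vnorm2_le_spec2.
Qed.

Lemma spec2_approx nr nt (H : 'M[C]_(nr, nt)) (e : R) : (0 < nt)%N -> 0 < e ->
  exists Q, admissible Q /\ spec2 H - e < wtr H Q.
Proof.
move=> n0 e0; have [_ [v /= v1 <-] h] := sup_adherent e0 (has_sup_spec_set H n0).
exists (v *m hermT v); split; last by rewrite wtr_vec.
split; first exact: psd_gram.
by rewrite mxtrace_mulC /mxtrace big_ord1 vnorm2E v1.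
Qed.


Lemma ldet1 n : ldet (1%:M : 'M[C]_n) = 0.
Proof. by rewrite /ldet det1 /= ln1. Qed.

Lemma re_trN n (X : 'M[C]_n) : re (\tr (- X)) = - re (\tr X).
Proof. by rewrite -[- X]add0r re_trB linear0 sub0r. Qed.

(** The tangent at [P], where [P >= 1] gives [P^-1 <= 1]. *)
Lemma ldet_diff_le n (P A : 'M[C]_n) : psd A -> psd (P - 1%:M) ->
  ldet (P + A) - ldet P <= re (\tr A).
Proof.
move=> pA pP1.
have pP : pd P.
  by rewrite -(subrK 1%:M P) addrC; apply: pd_addr; [exact: pd1 | exact: pP1].
have h1 := tangent (pd_addr pP pA) pP.
have h2 := psd_tr_mul_ge0 (inv_antitone (pd1 R n) pP1) pA.
rewrite invmx1 mulmxBl mul1mx re_trB in h2.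
rewrite addrAC subrr add0r in h1; lra.
Qed.

(** The tangent at [P + A], evaluated at [P], with [(P + A)^-1 >= c^-1]. *)
Lemma ldet_diff_ge n (P A : 'M[C]_n) (c : R) : psd A -> pd P -> 0 < c ->
  psd (c%:C *: 1%:M - (P + A)) -> re (\tr A) / c <= ldet (P + A) - ldet P.
Proof.
move=> pA pP c0 pc; have pPA := pd_addr pP pA.
have h1 := tangent pP pPA.
have h2 := psd_tr_mul_ge0 (inv_antitone pPA pc) pA.
rewrite opprD addNKr mulmxN re_trN in h1.
have iC : invmx (c%:C *: 1%:M : 'M[C]_n) = (c^-1)%:C *: 1%:M.
  rewrite invmxZ ?invmx1 ?fmorphV// unitmxZ ?unitmx1//.
  by rewrite unitfE (inj_eq (@complexI R)) gt_eqF.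
rewrite iC mulmxBl re_trB -scalemxAl mul1mx re_trZ mulrC in h2; lra.
Qed.

Lemma ldet_add_scalar n (P : 'M[C]_n) (t : R) : 0 <= t -> pd P ->
  ldet (P + t%:C *: 1%:M) = ldet P + ldet (1%:M + t%:C *: invmx P).
Proof.
move=> t0 pP; have p1 : pd (1%:M + t%:C *: invmx P).
  by apply: pd_addr; [exact: pd1 | apply: psdZ => //; exact: (pd_inv pP).1].
have -> : P + t%:C *: 1%:M = P *m (1%:M + t%:C *: invmx P).
  by rewrite mulmxDr mulmx1 -scalemxAr mulmxV//; exact: pP.2.
have p1' := re_det_gt0 p1.
rewrite /ldet det_mulmx; have [x x0 ->] := pd_det pP.
by rewrite reZ lnM.
Qed.

Lemma ler_sub_shift (x y p q u v : R) :
  x = p + u -> y = q + v -> u <= v -> x - p <= y - q.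
Proof. by move=> -> -> uv; rewrite ![_ + _ - _]addrAC !subrr !add0r. Qed.

Lemma ler_sub_cancel (x1 x2 x3 x4 u v y1 y2 y3 y4 : R) : x1 = u + y1 ->
  x2 = u + y2 -> x3 = v + y3 -> x4 = v + y4 -> y1 - y3 <= y2 - y4 ->
  x1 - x2 <= x3 - x4.
Proof. by move=> -> -> -> ->; lra. Qed.

(** Adding [t] times the identity to [P] raises [ldet] by [ldet (1 + t P^-1)], and [P^-1] decreases
    as [P] grows. *)
Lemma ldet_shift_antitone n (P A : 'M[C]_n) (t : R) : 0 <= t -> pd P -> psd A ->
  ldet (P + A + t%:C *: 1%:M) - ldet (P + A) <= ldet (P + t%:C *: 1%:M) - ldet P.
Proof.
move=> t0 pP pA; have pPA := pd_addr pP pA.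
suff h : ldet (1%:M + t%:C *: invmx (P + A)) <= ldet (1%:M + t%:C *: invmx P).
  exact: (ler_sub_shift (ldet_add_scalar t0 pPA) (ldet_add_scalar t0 pP) h).
apply: ldet_mono.
  by apply: pd_addr; [exact: pd1 | apply: (psdZ t0); exact: (pd_inv pPA).1].
rewrite opprD addrACA subrr add0r -scalerBr; apply: (psdZ t0).
apply: (inv_antitone pP); rewrite addrAC subrr add0r; exact: pA.
Qed.

Lemma pd_addZ n (A : 'M[C]_n) (t : R) : psd A -> 0 < t -> pd (A + t%:C *: 1%:M).
Proof.
by move=> pA t0; rewrite addrC; apply: (pd_addr _ pA); apply: (pdZ t0); exact: pd1.
Qed.

(** Trades the SNR [s] for white noise of level [1 / s], up to the additive term [n ln s]. *)
Lemma ldet_1DZ n (A : 'M[C]_n) (s : R) : 0 < s -> psd A ->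
  ldet (1%:M + s%:C *: A) = n%:R * ln s + ldet (A + s^-1%:C *: 1%:M).
Proof.
move=> s0 pA; have si : 0 < s^-1 by rewrite invr_gt0.
have e : 1%:M + s%:C *: A = s%:C *: (A + s^-1%:C *: 1%:M).
  by rewrite scalerDr scalerA -rmorphM divff ?gt_eqF// scale1r addrC.
by rewrite e (ldetZ s0 (pd_addZ pA si)).
Qed.

(** In each difference the terms [n ln s] cancel; what remains is [ldet_shift_antitone] for the drop
    [1 / s - 1 / s'] in noise level. *)
Lemma ldet_diff_nondecreasing n (A B : 'M[C]_n) (s s' : R) : 0 < s -> s <= s' ->
  psd A -> psd B ->
  ldet (1%:M + s%:C *: (A + B)) - ldet (1%:M + s%:C *: B)
  <= ldet (1%:M + s'%:C *: (A + B)) - ldet (1%:M + s'%:C *: B).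
Proof.
move=> s0 ss' pA pB; have s'0 := lt_le_trans s0 ss'.
have pAB := psdD pA pB.
have h1 := ldet_1DZ s0 pAB; have h2 := ldet_1DZ s0 pB.
have h3 := ldet_1DZ s'0 pAB; have h4 := ldet_1DZ s'0 pB.
have t'0 : 0 < s'^-1 by rewrite invr_gt0.
have tt : 0 <= s^-1 - s'^-1 by rewrite subr_ge0 lef_pV2.
have e (X : 'M[C]_n) : X + s^-1%:C *: 1%:M
    = (X + s'^-1%:C *: 1%:M) + (s^-1 - s'^-1)%:C *: 1%:M.
  by rewrite -addrA -scalerDl -rmorphD [s'^-1 + _]addrC addrNK.
have h5 := ldet_shift_antitone tt (pd_addZ pB t'0) pA.
have eP : B + s'^-1%:C *: 1%:M + A = (A + B) + s'^-1%:C *: 1%:M.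
  by rewrite addrC addrA.
have h6 : ldet (A + B + s^-1%:C *: 1%:M) - ldet (A + B + s'^-1%:C *: 1%:M)
    <= ldet (B + s^-1%:C *: 1%:M) - ldet (B + s'^-1%:C *: 1%:M).
  by rewrite (e (A + B)) (e B) -eP.
exact: (ler_sub_cancel h1 h2 h3 h4 h6).
Qed.

Section Pointwise.
Variables (nr nt : nat) (H : 'M[C]_(nr, nt)).
Implicit Types (X Y Q : 'M[C]_nt) (s : R).

Lemma psd_wishart s X : 0 <= s -> psd X -> psd (s%:C *: (H *m X *m hermT H)).
Proof. by move=> s0 pX; apply: psdZ => //; exact: psd_congr. Qed.

Lemma pd_gmi s X : 0 <= s -> psd X -> pd (1%:M + s%:C *: (H *m X *m hermT H)).
Proof. by move=> s0 pX; apply: pd_addr; [exact: pd1 | exact: psd_wishart]. Qed.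

Lemma gmiD s X Y : gmi s H (X + Y) =
  ldet (1%:M + s%:C *: (H *m Y *m hermT H) + s%:C *: (H *m X *m hermT H)).
Proof. by rewrite /gmi congrD scalerDr [X in _ + X]addrC addrA. Qed.

Lemma gmi_diff_le s Q Y : 0 <= s -> psd Q -> psd Y ->
  gmi s H (Q + Y) - gmi s H Y <= s * wtr H Q.
Proof.
move=> s0 pQ pY; rewrite gmiD /gmi.
have pP1 : psd (1%:M + s%:C *: (H *m Y *m hermT H) - 1%:M).
  by rewrite addrAC subrr add0r; exact: psd_wishart.
by have := ldet_diff_le (psd_wishart s0 pQ) pP1; rewrite re_trZ.
Qed.

(** One plus the trace of received signal and distortion dominates [1 + s H (Q + Y) H^H]; it serves
    as the scalar [c] of [ldet_diff_ge]. *)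
Lemma gmi_diff_ge s Q Y : 0 <= s -> psd Q -> psd Y ->
  s * wtr H Q / (1 + s * wtr H (Q + Y)) <= gmi s H (Q + Y) - gmi s H Y.
Proof.
move=> s0 pQ pY; rewrite gmiD /gmi.
have c0 : 0 < 1 + s * wtr H (Q + Y).
  by apply: (ltr_pwDl ltr01); apply: (mulr_ge0 s0); apply: wtr_ge0; exact: psdD.
suff pc : psd ((1 + s * wtr H (Q + Y))%:C *: 1%:M -
    (1%:M + s%:C *: (H *m Y *m hermT H) + s%:C *: (H *m Q *m hermT H))).
  by have := ldet_diff_ge (psd_wishart s0 pQ) (pd_gmi s0 pY) c0 pc; rewrite re_trZ.
have := psd_tr_sub1 (psd_wishart s0 (psdD pQ pY)).
rewrite re_trZ -/(wtr H (Q + Y)).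
have -> : 1%:M + s%:C *: (H *m (Q + Y) *m hermT H) =
    1%:M + s%:C *: (H *m Y *m hermT H) + s%:C *: (H *m Q *m hermT H).
  by rewrite congrD scalerDr addrAC addrA.
exact: id.
Qed.

Lemma gmi_le_wtr s X : 0 <= s -> psd X -> gmi s H X <= s * wtr H X.
Proof.
move=> s0 pX; have := @ldet_diff_le _ 1%:M _ (psd_wishart s0 pX).
by rewrite subrr ldet1 subr0 re_trZ; apply; exact: psd0.
Qed.

Lemma gmi_mono s X Y : 0 <= s -> psd X -> psd (Y - X) -> gmi s H X <= gmi s H Y.
Proof.
move=> s0 pX pYX; have e : Y = (Y - X) + X by rewrite subrK.
rewrite [in leRHS]e gmiD; apply: ldet_mono; first exact: pd_gmi.
by rewrite addrAC subrr add0r; exact: psd_wishart.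
Qed.

Lemma gmi_ge0 s X : 0 <= s -> psd X -> 0 <= gmi s H X.
Proof.
move=> s0 pX; rewrite -(ldet1 nr) /gmi; apply: ldet_mono; first exact: pd1.
by rewrite addrAC subrr add0r; exact: psd_wishart.
Qed.

Lemma gmi_diff_nondecreasing s s' Q Y : 0 < s -> s <= s' -> psd Q -> psd Y ->
  gmi s H (Q + Y) - gmi s H Y <= gmi s' H (Q + Y) - gmi s' H Y.
Proof.
move=> s0 ss' pQ pY; rewrite /gmi !congrD.
by apply: ldet_diff_nondecreasing => //; exact: psd_congr.
Qed.

Lemma ldet_ratio n (P A : 'M[C]_n) : pd P -> psd A ->
  ln (re (\det (1%:M + A *m invmx P))) = ldet (P + A) - ldet P.
Proof.
move=> pP pA; have := re_det_gt0 (pd_addr pP pA).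
have -> : P + A = (1%:M + A *m invmx P) *m P.
  by rewrite mulmxDl mul1mx mulmxKV//; exact: pP.2.
rewrite /ldet det_mulmx mulrC; have [x x0 ->] := pd_det pP.
by rewrite reZ pmulr_rgt0// => y0; rewrite lnM// addrAC subrr add0r.
Qed.

Lemma gmi_rate kappa alpha s Q : 0 <= s -> psd Q -> psd (Upsilon kappa alpha Q) ->
  rate kappa alpha s Q H =
  (gmi s H (Q + Upsilon kappa alpha Q) - gmi s H (Upsilon kappa alpha Q)) / ln 2.
Proof.
move=> s0 pQ pY; rewrite /rate /log2; congr (_ / _).
rewrite [X in invmx X]addrC gmiD /gmi.
by apply: ldet_ratio; [exact: pd_gmi | exact: psd_wishart].
Qed.

End Pointwise.
End ChannelInequalities.

(** * Reduction to a channel of full row rank *)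

Section RankReduction.
Variable R : realType.
Local Notation C := R[i].
Local Notation re := (@complex.Re R).

(** Sylvester's determinant identity: the block matrices [M] and [N] have block triangular products
    in both orders, and the two products have equal determinants. *)
Lemma det_1D_mulmxC (F : comNzRingType) m n (A : 'M[F]_(m, n)) (B : 'M[F]_(n, m)) :
  \det (1%:M + A *m B) = \det (1%:M + B *m A).
Proof.
pose M := block_mx 1%:M (- A) B 1%:M.
pose N := block_mx 1%:M 0 (- B) 1%:M : 'M[F]_(m + n).
have e1 : M *m N = block_mx (1%:M + A *m B) (- A) 0 1%:M.
  by rewrite mulmx_block !mulmx1 !mul1mx !mulmx0 mulNmx mulmxN opprK subrr !add0r.
have e2 : N *m M = block_mx 1%:M (- A) 0 (1%:M + B *m A).
  rewrite mulmx_block !mulmx1 !mul1mx !mul0mx mulNmx mulmxN opprK.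
  by rewrite !addr0 addNr [_ + 1%:M]addrC.
have := congr1 determinant e1; have := congr1 determinant e2.
rewrite !det_mulmx !det_ublock !det1 mul1r mulr1 => <- <-.
by rewrite mulrC.
Qed.

Lemma frob2_eq0 m n (A : 'M[C]_(m, n)) : frob2 A = 0 -> A = 0.
Proof.
move=> /eqP; rewrite psumr_eq0; last by move=> i _; apply: sumr_ge0 => j _; exact: abs2_ge0.
move=> /allP h; apply/matrixP => i j; rewrite mxE.
have := h i (mem_index_enum _); rewrite psumr_eq0 => [|k _]; last exact: abs2_ge0.
by move=> /allP /(_ j (mem_index_enum _)) /eqP; exact: abs2_eq0.
Qed.

(** If [N] spans the left kernel of [K K^H], then [|N K|_F^2 = tr (N K K^H N^H) = 0], so [N K = 0]
    and hence [N = 0]. *)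
Lemma pd_gram_row_free m n (K : 'M[C]_(m, n)) : row_free K -> pd (K *m hermT K).
Proof.
move=> fK; split; first exact: psd_gram.
rewrite -row_free_unit -kermx_eq0; set N := kermx _.
have NK : N *m K = 0.
  apply: frob2_eq0; apply: complexI; rewrite -tr_mul_hermT hermT_mul.
  have -> : N *m K *m (hermT K *m hermT N) = (N *m (K *m hermT K)) *m hermT N.
    by rewrite !mulmxA.
  by rewrite mulmx_ker mul0mx linear0.
by rewrite -(mulmx_free_eq0 _ fK) NK.
Qed.

(* Factoring [H = L K] through its rank moves [L] into the noise covariance. *)
Lemma gmi_compress nr nt (H : 'M[C]_(nr, nt)) :
  exists (E : 'M[C]_(\rank H)) (K : 'M[C]_(\rank H, nt)) (c : R),
    [/\ pd E, pd (K *m hermT K), (exists L, H = L *m K) &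
      forall s X, 0 <= s -> psd X ->
        gmi s H X = c + ldet (E + s%:C *: (K *m X *m hermT K))].
Proof.
set L := col_base H; set K := row_base H.
have eH : H = L *m K by rewrite mulmx_base.
have pG : pd (hermT L *m L).
  have fL : row_free (hermT L).
    rewrite /row_free /hermT mxrank_tr mxrank_map; exact: col_base_full.
  by have := pd_gram_row_free fL; rewrite hermTK.
have pE := pd_inv pG.
exists (invmx (hermT L *m L)), K, (ldet (hermT L *m L)); split.
- exact: pE.
- apply: pd_gram_row_free; exact: row_base_free.
- by exists L.
move=> s X s0 pX.
have pB : psd (s%:C *: (K *m X *m hermT K)) by apply: psdZ => //; exact: psd_congr.
have eD : \det (1%:M + s%:C *: (H *m X *m hermT H)) =
    \det (invmx (hermT L *m L) + s%:C *: (K *m X *m hermT K)) * \det (hermT L *m L).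
  have -> : s%:C *: (H *m X *m hermT H) =
      L *m ((s%:C *: (K *m X *m hermT K)) *m hermT L).
    by rewrite {1 2}eH hermT_mul -scalemxAl -scalemxAr !mulmxA.
  (* Sylvester's identity carries [L] to the other side, where [L^H L] factors out and leaves its
     inverse as noise covariance. *)
  rewrite det_1D_mulmxC -det_mulmx mulmxDl mulVmx; last exact: pG.2.
  by rewrite -!mulmxA.
rewrite /gmi /ldet eD; have [x x0 ->] := pd_det (pd_addr pE pB).
by rewrite reZ lnM ?posrE ?(re_det_gt0 pG)// addrC.
Qed.

Section Reduced.
Variables (r nt : nat) (E : 'M[C]_r) (K : 'M[C]_(r, nt)).
Hypothesis pE : pd E.

(** By the matrix inversion lemma this matrix is [(1 + W^H E^-1 W)^-1]. *)
Lemma woodbury_psd (W : 'M[C]_(r, nt)) :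
  psd (1%:M - hermT W *m invmx (E + W *m hermT W) *m W).
Proof.
set P := E + W *m hermT W; have pP : pd P by apply: (pd_addr pE); exact: psd_gram.
set Z := 1%:M + hermT W *m invmx E *m W.
have pZ : pd Z.
  apply: pd_addr; first exact: pd1.
  rewrite -{2}[W]hermTK; apply: psd_congr; exact: (pd_inv pE).1.
have e : Z *m (1%:M - hermT W *m invmx P *m W) = 1%:M.
  have key : invmx E *m (W *m hermT W) *m invmx P = invmx E - invmx P.
    have -> : W *m hermT W = P - E by rewrite /P addrAC subrr add0r.
    rewrite mulmxBr mulmxBl -mulmxA (mulmxV pP.2) mulmx1 (mulVmx pE.2) mul1mx //.
  rewrite mulmxBr mulmx1 /Z mulmxDl mul1mx.
  have -> : hermT W *m invmx E *m W *m (hermT W *m invmx P *m W)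
      = hermT W *m (invmx E *m (W *m hermT W) *m invmx P) *m W.
    by rewrite !mulmxA.
  rewrite key mulmxBr mulmxBl [hermT W *m invmx P *m W + _]addrC subrK addrK //.
have -> : 1%:M - hermT W *m invmx P *m W = invmx Z.
  by apply: (can_inj (mulKmx pZ.2)); rewrite e (mulmxV pZ.2).
exact: (pd_inv pZ).1.
Qed.

(** Rescale the inputs to unit distortion power: with [W = sqrt s K D] and [Q' = D^-1 Q D^-1] the
    left side is [tr (W^H P^-1 W Q')], where [P = E + W W^H], and [woodbury_psd] bounds it by
    [tr Q']. *)
Lemma trace_ratio_le (s : R) (u : 'I_nt -> R) (Q : 'M[C]_nt) : 0 <= s ->
  (forall k, 0 <= u k) -> psd Q -> (forall k, u k = 0 -> re (Q k k) = 0) ->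
  re (\tr (invmx (E + s%:C *: (K *m rdiag u *m hermT K))
             *m (s%:C *: (K *m Q *m hermT K)))) <= \sum_k re (Q k k) / u k.
Proof.
move=> s0 u0 pQ uQ.
set D := rdiag (fun k => Num.sqrt (u k)).
(* Where [u k = 0] the inverse takes its default value 0; [D Q' D = Q] still holds because row and
   column [k] of [Q] vanish there. *)
set D' := rdiag (fun k => (Num.sqrt (u k))^-1).
set Q' := D' *m Q *m D'.
have pQ' : psd Q' by rewrite /Q' -{2}[D']hermT_rdiag; exact: psd_congr.
have diagE n (d : 'I_n -> R) (A : 'M[C]_n) i j : (rdiag d *m A) i j = (d i)%:C * A i j.
  by rewrite /rdiag mul_diag_mx !mxE.
have diagE' n (d : 'I_n -> R) (A : 'M[C]_n) i j : (A *m rdiag d) i j = A i j * (d j)%:C.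
  by rewrite /rdiag mul_mx_diag !mxE.
have eQ : D *m Q' *m D = Q.
  apply/matrixP => i j; rewrite /Q' diagE' diagE diagE' diagE.
  have [ui|ui] := eqVneq (u i) 0.
    by rewrite (psd_diag_eq0 pQ (uQ i ui) j).1 !(mul0r, mulr0).
  have [uj|uj] := eqVneq (u j) 0.
    by rewrite (psd_diag_eq0 pQ (uQ j uj) i).2 !(mul0r, mulr0).
  have nz k : u k != 0 -> (Num.sqrt (u k))%:C != 0 :> C.
    by move=> uk; rewrite (inj_eq (@complexI R)) gt_eqF// sqrtr_gt0 lt_neqAle eq_sym uk u0.
  rewrite !fmorphV; field; by rewrite !nz.
set W := (Num.sqrt s)%:C *: (K *m D).
have ss : (Num.sqrt s)%:C * (Num.sqrt s)%:C = s%:C :> C.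
  by rewrite -rmorphM -expr2 sqr_sqrtr.
have eWX X : W *m X *m hermT W = s%:C *: (K *m (D *m X *m D) *m hermT K).
  rewrite /W hermTZ hermT_mul hermT_rdiag -!scalemxAl -scalemxAr scalerA ss.
  by rewrite !mulmxA.
have DD : D *m 1%:M *m D = rdiag u.
  rewrite mulmx1 mulmx_rdiag; congr rdiag; apply/funext => k.
  by rewrite -expr2 sqr_sqrtr.
have := eWX 1%:M; rewrite DD mulmx1 => <-.
have := eWX Q'; rewrite eQ => <-.
have := psd_tr_mul_ge0 (woodbury_psd W) pQ'.
rewrite mulmxBl mul1mx re_trB subr_ge0.
have -> : \tr (hermT W *m invmx (E + W *m hermT W) *m W *m Q') =
   \tr (invmx (E + W *m hermT W) *m (W *m Q' *m hermT W)).
  by rewrite -!mulmxA mxtrace_mulC -!mulmxA.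
move=> h; apply: (le_trans h).
rewrite /mxtrace re_sum; apply: ler_sum => k _.
rewrite /Q' diagE' diagE mulrAC -rmorphM reZ -invfM -expr2 sqr_sqrtr//.
by rewrite mulrC.
Qed.

(** At the tangent point [(1 + t) P] the trace bound makes the linear term nonpositive, and the
    scaling contributes [r ln (1 + t)]. *)
Lemma ldet_diff_le_ratio (P A : 'M[C]_r) (t : R) : 0 <= t -> pd P -> psd A ->
  re (\tr (invmx P *m A)) <= t * r%:R ->
  ldet (P + A) - ldet P <= r%:R * ln (1 + t).
Proof.
move=> t0 pP pA h; have t1 : 0 < 1 + t by rewrite ltr_pwDl.
have := tangent (pd_addr pP pA) (pdZ t1 pP).
rewrite (ldetZ t1 pP).
have -> : P + A - (1 + t)%:C *: P = A - t%:C *: P.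
  by rewrite rmorphD scalerDl scale1r opprD addrACA subrr add0r.
have -> : invmx ((1 + t)%:C *: P) = (1 + t)^-1%:C *: invmx P.
  rewrite invmxZ ?fmorphV//; exact: (pdZ t1 pP).2.
rewrite -scalemxAl re_trZ mulmxBr re_trB -scalemxAr re_trZ (mulVmx pP.2).
have -> : re (\tr (1%:M : 'M[C]_r)) = r%:R by rewrite mxtrace1 -(rmorph_nat (real_complex R)).
move=> h2; have h3 : (1 + t)^-1 * (re (\tr (invmx P *m A)) - t * r%:R) <= 0.
  by rewrite pmulr_rle0 ?invr_gt0// subr_le0.
by rewrite lerBlDr; apply: (le_trans h2); rewrite gerDl.
Qed.

(** [E + c B] lies below [c (E + B)], whose log-determinant exceeds that of [E + B] by [r ln c]. *)
Lemma ldet_scale_le (B : 'M[C]_r) (c : R) : 1 <= c -> psd B ->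
  ldet (E + c%:C *: B) - ldet (E + B) <= r%:R * ln c.
Proof.
move=> c1 pB; have c0 : 0 < c by exact: lt_le_trans c1.
rewrite lerBlDr -(ldetZ c0 (pd_addr pE pB)); apply: ldet_mono.
  by apply: (pd_addr pE); apply: (psdZ (ltW c0)).
have -> : c%:C *: (E + B) - (E + c%:C *: B) = (c - 1)%:C *: E.
  by rewrite scalerDr opprD addrACA subrr addr0 rmorphB scalerBl scale1r.
by apply: psdZ; [rewrite subr_ge0 | exact: pE.1].
Qed.

Lemma ler_sub_chain (a b t x y : R) : a + b <= x -> y <= b + t -> a - t <= x - y.
Proof. lra. Qed.

(** Drop [E] from the first term and use the tangent at [B] for the second. The error [tr (B^-1 E)]
    is of order [1 / s] when [B] is proportional to [s]. *)
Lemma ldet_scale_ge (B : 'M[C]_r) (c : R) : 1 <= c -> pd B ->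
  r%:R * ln c - re (\tr (invmx B *m E)) <= ldet (E + c%:C *: B) - ldet (E + B).
Proof.
move=> c1 pB; have c0 : 0 < c by exact: lt_le_trans c1.
have cB := pdZ c0 pB.
have h1 : r%:R * ln c + ldet B <= ldet (E + c%:C *: B).
  rewrite -(ldetZ c0 pB); apply: (ldet_mono cB); rewrite addrK; exact: pE.1.
have := tangent (pd_addr pE pB.1) pB; rewrite addrK => h2.
exact: (ler_sub_chain h1 h2).
Qed.

End Reduced.
End RankReduction.

(** * Convex sets of matrices stable under unitary conjugation: passing to the diagonal *)

Section UnitaryAveraging.
Variable R : realType.
Local Notation C := R[i].
Variables (n : nat) (S : 'M[C]_n -> Prop).
Hypothesis S_conv : forall (t : R) A B, 0 <= t <= 1 -> S A -> S B ->
  S (t%:C *: A + (1 - t)%:C *: B).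
Hypothesis S_unitary : forall U A, unitary U -> S A -> S (U *m A *m hermT U).

Lemma S_halves A B : S A -> S B -> S (2^-1%:C *: A + 2^-1%:C *: B).
Proof.
move=> SA SB; have h : 0 <= (2^-1 : R) <= 1 by apply/andP; split; lra.
have := S_conv h SA SB; have -> : 1 - 2^-1 = 2^-1 :> R by lra.
exact: id.
Qed.

Lemma S_mean m (Z : nat -> 'M[C]_n) : (forall j, S (Z j)) ->
  S (m.+1%:R^-1%:C *: \sum_(j < m.+1) Z j).
Proof.
move=> SZ; elim: m => [|m IH].
  by rewrite big_ord1 invr1 scale1r.
have h : 0 <= (m.+1%:R / m.+2%:R : R) <= 1.
  by rewrite divr_ge0//= ler_pdivrMr// mul1r ler_nat.
have := S_conv h IH (SZ m.+1).
have m2 : m.+2%:R != 0 :> R by rewrite pnatr_eq0.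
have m1 : m.+1%:R != 0 :> R by rewrite pnatr_eq0.
have -> : 1 - m.+1%:R / m.+2%:R = m.+2%:R^-1 :> R.
  by apply: (mulIf m2); rewrite mulrBl mulVf// divfK// mul1r -natrB// subSnn.
rewrite scalerA -rmorphM mulrAC divff// mul1r -scalerDr.
by rewrite [in X in _ -> X]big_ord_recr.
Qed.

Definition signs (i : nat) := rdiag (fun k : 'I_n => if k == i :> nat then -1 else 1 : R).

Lemma unitary_signs i : unitary (signs i).
Proof.
rewrite /unitary hermT_rdiag mulmx_rdiag -rdiag1; congr rdiag; apply/funext => k.
by case: ifP; rewrite ?mulrNN mulr1.
Qed.

(** Interpolates between [A] at [m = 0] and its diagonal at [m = n]. *)
Definition cut (A : 'M[C]_n) (m : nat) : 'M[C]_n :=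
  \matrix_(j, k) (if (j == k) || ((m <= j) && (m <= k))%N then A j k else 0).

(** Conjugation by [signs m] negates exactly the off-diagonal entries of row and column [m], so the
    mean with the original clears them. *)
Lemma S_cut A m : S A -> S (cut A m).
Proof.
move=> SA; elim: m => [|m IH].
  by have -> : cut A 0 = A by apply/matrixP => j k; rewrite mxE /= orbT.
have := S_halves IH (S_unitary (unitary_signs m) IH); rewrite hermT_rdiag.
set X := (X in S X -> _); suff -> : cut A m.+1 = X by [].
apply/matrixP => j k; rewrite /X /signs /rdiag mul_diag_mx mul_mx_diag !mxE.
have halves : 2^-1 + 2^-1 = 1 :> R by lra.
have half (z : C) : 2^-1%:C * z + 2^-1%:C * z = z.
  by rewrite -mulrDl -rmorphD halves mul1r.
have halfN (z : C) : 2^-1%:C * z + 2^-1%:C * (- z) = 0 by rewrite mulrN subrr.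
have [->|jk] := eqVneq j k.
  by rewrite /=; case: ifP => _; rewrite ?rmorphN rmorph1 ?mulN1r ?mulrN1 ?opprK ?mul1r ?mulr1 half.
rewrite /=.
have [jm|jm] := eqVneq (j : nat) m.
  have km : (k == m :> nat) = false.
    by apply: contra_neqF jk => /eqP km; apply/val_inj; rewrite /= jm km.
  rewrite km ltn_neqAle [m == j]eq_sym jm eqxx /= rmorphN rmorph1 mulN1r mulr1.
  by rewrite halfN.
have [km|km] := eqVneq (k : nat) m.
  rewrite [(m < k)%N]ltn_neqAle [m == k]eq_sym km eqxx /= andbF rmorphN rmorph1.
  by rewrite mul1r mulrN1 halfN.
by rewrite !rmorph1 mul1r mulr1 half !ltn_neqAle ![m == _]eq_sym jm km.
Qed.

Lemma S_diag A : S A -> S (diag_mx (\row_k A k k)).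
Proof.
move=> /(S_cut n).
suff -> : cut A n = diag_mx (\row_k A k k) by [].
apply/matrixP => j k; rewrite !mxE leqNgt ltn_ord /= orbF.
by case: eqVneq => [->|_]; rewrite ?mulr1n ?mulr0n.
Qed.

End UnitaryAveraging.

(** * Averaging the diagonal down to the trace *)

Section UnitaryAveragingTrace.
Variable R : realType.
Local Notation C := R[i].

Lemma unitary_perm n (s : {perm 'I_n}) : unitary (perm_mx s : 'M[C]_n).
Proof.
rewrite /unitary /hermT map_perm_mx tr_perm_mx -perm_mxM mulgV perm_mx1 //.
Qed.

Lemma perm_diag_congr n (s : {perm 'I_n}) (a : 'I_n -> C) :
  perm_mx s *m diag_mx (\row_k a k) *m hermT (perm_mx s)
  = diag_mx (\row_k a (s k)).
Proof.
rewrite /hermT map_perm_mx tr_perm_mx -row_permE -col_permE.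
by apply/matrixP => i j; rewrite !mxE (inj_eq perm_inj).
Qed.

(** The cyclic shift [k |-> j + k] modulo [n + 1]. *)
Definition shift_perm n (j : nat) : {perm 'I_n.+1} := perm (@addrI 'I_n.+1 (inord j)).

(** Under the cyclic shifts each diagonal entry visits each position once, so the mean of the
    shifted diagonals is scalar. *)
Lemma S_trace n (S : 'M[C]_n -> Prop) (A : 'M[C]_n) : (0 < n)%N ->
  (forall (t : R) A B, 0 <= t <= 1 -> S A -> S B -> S (t%:C *: A + (1 - t)%:C *: B)) ->
  (forall U A, unitary U -> S A -> S (U *m A *m hermT U)) ->
  S A -> S ((n%:R^-1%:C * \tr A) *: 1%:M).
Proof.
case: n S A => // n S A _ Sc Su SA.
have SD := S_diag Sc Su SA.
have := S_mean Sc n (fun j => Su _ _ (unitary_perm (shift_perm n j)) SD).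
suff -> : (n.+1%:R^-1)%:C *: (\sum_(j < n.+1) (perm_mx (shift_perm n j) *m
     diag_mx (\row_k A k k) *m hermT (perm_mx (shift_perm n j)))) =
  ((n.+1%:R^-1)%:C * \tr A) *: 1%:M by [].
rewrite -scalerA; congr (_ *: _); apply/matrixP => i k.
rewrite summxE !mxE.
under eq_bigr do rewrite (perm_diag_congr _ (fun k => A k k)) !mxE permE.
rewrite sumrMnl mulr_natr; congr (_ *+ _).
rewrite /mxtrace [RHS](reindex_inj (addIr i)); apply: eq_bigr => j _.
by rewrite inord_val.
Qed.

End UnitaryAveragingTrace.

(** * Distortion powers and mutual information bounds for an admissible covariance *)

Section DistortedChannel.
Variable R : realType.
Local Notation C := R[i].
Local Notation re := (@complex.Re R).

Definition ups n (kappa alpha : R) (Q : 'M[C]_n) (k : 'I_n) : R :=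
  kappa ^+ 2 * ((1 - alpha) * re (Q k k)
    + alpha * (n%:R)^-1 * \sum_(i < n) re (Q i i)).

Lemma UpsilonE n kappa alpha (Q : 'M[C]_n) :
  Upsilon kappa alpha Q = rdiag (ups kappa alpha Q).
Proof. by []. Qed.

Lemma addDBl (c x y : R) : c + x - (c + y) = x - y.
Proof. by rewrite opprD addrACA subrr add0r. Qed.

Section OneChannel.
Variables (nr nt : nat) (kappa alpha : R).
Hypothesis nt0 : (0 < nt)%N.
Hypothesis kappa0 : 0 < kappa.
Hypothesis alpha01 : 0 <= alpha <= 1.
Implicit Types (H : 'M[C]_(nr, nt)) (Q X Y : 'M[C]_nt).

Let ntR : 0 < nt%:R :> R. Proof. by rewrite ltr0n. Qed.
Let k2 : 0 < kappa ^+ 2. Proof. exact: exprn_gt0. Qed.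

Lemma admissible_tr Q : admissible Q -> \sum_(i < nt) re (Q i i) = 1.
Proof.
move=> [_ tQ]; rewrite -re_sum -/(\tr Q) tQ //.
Qed.

Lemma ups_admissible Q k : admissible Q -> ups kappa alpha Q k =
  kappa ^+ 2 * ((1 - alpha) * re (Q k k) + alpha / nt%:R).
Proof. by move=> aQ; rewrite /ups admissible_tr// mulr1. Qed.

Lemma ups_ge0 Q k : admissible Q -> 0 <= ups kappa alpha Q k.
Proof.
move=> aQ; rewrite ups_admissible//; have q0 := psd_diag_ge0 k aQ.1.
case/andP: alpha01 => a0 a1.
by rewrite mulr_ge0 ?(ltW k2)// addr_ge0// ?mulr_ge0 ?divr_ge0 ?subr_ge0 ?(ltW ntR).
Qed.

Lemma psd_Upsilon Q : admissible Q -> psd (Upsilon kappa alpha Q).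
Proof. by move=> aQ; rewrite UpsilonE; apply: psd_rdiag => k; exact: ups_ge0. Qed.

Lemma re_tr_Upsilon Q : admissible Q -> re (\tr (Upsilon kappa alpha Q)) = kappa ^+ 2.
Proof.
move=> aQ; rewrite UpsilonE tr_rdiag /=.
under eq_bigr do rewrite ups_admissible//.
rewrite -mulr_sumr big_split /= -mulr_sumr admissible_tr// sumr_const card_ord.
rewrite -[X in _ + X]mulr_natr divfK ?gt_eqF//; ring.
Qed.

(** A zero distortion power forces [alpha = 0], and then it is [kappa^2] times the diagonal
    entry. *)
Lemma ups_eq0 Q k : admissible Q -> ups kappa alpha Q k = 0 -> re (Q k k) = 0.
Proof.
move=> aQ; rewrite ups_admissible// => /eqP; have q0 := psd_diag_ge0 k aQ.1.
case/andP: alpha01 => a0 a1.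
have h1 : 0 <= (1 - alpha) * re (Q k k) by rewrite mulr_ge0// subr_ge0.
have h2 : 0 <= alpha / nt%:R by rewrite divr_ge0// ltW.
rewrite mulf_eq0 gt_eqF//= paddr_eq0// => /andP[h3 h4].
move: h4; rewrite mulf_eq0 invr_eq0 (gt_eqF ntR) orbF => /eqP al0.
by move: h3; rewrite al0 subr0 mul1r => /eqP.
Qed.

(* The tangent at [1 / nt] of the concave function
   [q |-> q / ((1 - alpha) q + alpha / nt)]. *)
Lemma ratio_ups_le Q k : admissible Q ->
  re (Q k k) / ups kappa alpha Q k
  <= (1 + alpha * (nt%:R * re (Q k k) - 1)) / kappa ^+ 2.
Proof.
move=> aQ; have q0 := psd_diag_ge0 k aQ.1; have u0 := ups_ge0 k aQ.
case/andP: alpha01 => a0 a1.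
have N0 := ntR; set N : R := nt%:R in N0 *.
(* A zero distortion power makes the quotient 0 by convention, while the right side is nonnegative
   since [alpha <= 1]. *)
have [uz|un] := eqVneq (ups kappa alpha Q k) 0.
  rewrite uz invr0 mulr0; apply: divr_ge0; last exact: ltW.
  have : 0 <= alpha * (N * re (Q k k)) by rewrite !mulr_ge0// ltW.
  by move: q0 a1 => _; lra.
have up : 0 < ups kappa alpha Q k by rewrite lt_neqAle eq_sym un u0.
rewrite ler_pdivrMr// ups_admissible//.
(* After clearing the denominator, the gap to the tangent is a nonnegative multiple of a square. *)
have -> : (1 + alpha * (N * re (Q k k) - 1)) / kappa ^+ 2 *
    (kappa ^+ 2 * ((1 - alpha) * re (Q k k) + alpha / N)) =
    re (Q k k) + alpha * (1 - alpha) * (N * re (Q k k) - 1) ^+ 2 / N.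
  by field; rewrite (gt_eqF N0) gt_eqF.
rewrite lerDl; apply: divr_ge0; last exact: ltW.
by rewrite mulr_ge0 ?sqr_ge0// mulr_ge0// subr_ge0.
Qed.

(** The first-order terms sum to zero because [Q] has trace 1, leaving [nt] copies of
    [1 / kappa^2]. *)
Lemma sum_ratio_ups_le Q : admissible Q ->
  \sum_k re (Q k k) / ups kappa alpha Q k <= nt%:R / kappa ^+ 2.
Proof.
move=> aQ; apply: (@le_trans _ _ (\sum_(k < nt)
    (1 + alpha * (nt%:R * re (Q k k) - 1)) / kappa ^+ 2)).
  by apply: ler_sum => k _; exact: ratio_ups_le.
rewrite -mulr_suml ler_pM2r ?invr_gt0// big_split /= sumr_const card_ord.
rewrite -mulr_sumr sumrB -mulr_sumr admissible_tr// sumr_const card_ord.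
by rewrite mulr1 subrr mulr0 addr0.
Qed.

(** The ratio [t = nt / (rank H * kappa^2)] makes [t * rank H] the bound that [sum_ratio_ups_le]
    puts on the trace. *)
Lemma gmi_diff_le_full H Q s : admissible Q -> 0 <= s -> (0 < \rank H)%N ->
  gmi s H (Q + Upsilon kappa alpha Q) - gmi s H (Upsilon kappa alpha Q)
  <= (\rank H)%:R * ln (1 + nt%:R / ((\rank H)%:R * kappa ^+ 2)).
Proof.
move=> aQ s0 r0; have [E [K [c [pE _ _ eH]]]] := gmi_compress H.
have pY := psd_Upsilon aQ; have pQ := aQ.1.
rewrite (eH _ _ s0 (psdD pQ pY)) (eH _ _ s0 pY) congrD scalerDr addDBl.
set A := s%:C *: (K *m Q *m hermT K).
set B := s%:C *: (K *m Upsilon kappa alpha Q *m hermT K).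
have pA : psd A by apply: (psdZ s0); exact: psd_congr.
have pB : psd B by apply: (psdZ s0); exact: psd_congr.
have rR : 0 < (\rank H)%:R :> R by rewrite ltr0n.
have -> : E + (A + B) = E + B + A by rewrite [A + B]addrC addrA.
apply: (ldet_diff_le_ratio _ (pd_addr pE pB) pA).
  by apply: divr_ge0; [exact: ltW | exact: ltW (mulr_gt0 rR k2)].
have -> : nt%:R / ((\rank H)%:R * kappa ^+ 2) * (\rank H)%:R = nt%:R / kappa ^+ 2.
  by field; rewrite !gt_eqF.
apply: le_trans (sum_ratio_ups_le aQ).
have := @trace_ratio_le _ _ _ E K pE s (ups kappa alpha Q) Q s0.
by apply=> // k; [exact: ups_ge0 | exact: ups_eq0].
Qed.

(** Compressing first makes the factor the rank of [H] instead of [nr]. *)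
Lemma gmi_scale_le H Y s c : psd Y -> 0 <= s -> 1 <= c ->
  gmi s H (c%:C *: Y) - gmi s H Y <= (\rank H)%:R * ln c.
Proof.
move=> pY s0 c1; have [E [K [c' [pE _ _ eH]]]] := gmi_compress H.
have c0 : 0 <= c by exact: le_trans c1.
rewrite (eH _ _ s0 (psdZ c0 pY)) (eH _ _ s0 pY) congrZ scalerA mulrC -scalerA.
rewrite addDBl; apply: (ldet_scale_le pE c1).
by apply: (psdZ s0); exact: psd_congr.
Qed.

(** [K0 = tr ((K K^H)^-1 E) / y] depends on [H] but not on [s], so the bound of [gmi_scale_le] is
    reached in the limit for a white covariance. *)
Lemma gmi_scale_ge H (y c : R) : 0 < y -> 1 <= c -> exists K0, forall s, 0 < s ->
  (\rank H)%:R * ln c - K0 / s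
  <= gmi s H ((c * y)%:C *: 1%:M) - gmi s H (y%:C *: 1%:M).
Proof.
move=> y0 c1; have [E [K [c' [pE pK _ eH]]]] := gmi_compress H.
exists (re (\tr (invmx (K *m hermT K) *m E)) / y) => s s0.
have c0 : 0 <= c by exact: le_trans c1.
have p1 := psd1 R nt.
rewrite (eH _ _ (ltW s0) (psdZ (mulr_ge0 c0 (ltW y0)) p1)).
rewrite (eH _ _ (ltW s0) (psdZ (ltW y0) p1)) addDBl.
have sy : 0 < s * y by rewrite mulr_gt0.
have h := ldet_scale_ge pE c1 (pdZ sy pK).
have e z : s%:C *: (K *m (z%:C *: 1%:M) *m hermT K) = (s * z)%:C *: (K *m hermT K).
  by rewrite congrZ mulmx1 scalerA -rmorphM.
have e' : c%:C *: ((s * y)%:C *: (K *m hermT K)) = (s * (c * y))%:C *: (K *m hermT K).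
  by rewrite scalerA -rmorphM mulrCA.
rewrite (e (c * y)) (e y) -e'; apply: (le_trans _ h); rewrite lerD2l lerN2.
have -> : invmx ((s * y)%:C *: (K *m hermT K)) = (s * y)^-1%:C *: invmx (K *m hermT K).
  by rewrite invmxZ ?fmorphV//; exact: (pdZ sy pK).2.
rewrite -scalemxAl re_trZ invfM; set t := re _.
by have -> : s^-1 / y * t = t / y / s by ring.
Qed.

Lemma isotropic_admissible : admissible (nt%:R^-1%:C *: 1%:M : 'M[C]_nt).
Proof.
split; first by apply: psdZ; [rewrite invr_ge0 ltW | exact: psd1].
rewrite linearZ /= mxtrace1 -(rmorph_nat (real_complex R)) -rmorphM mulVf// gt_eqF//.
Qed.

Lemma Upsilon_isotropic :
  Upsilon kappa alpha (nt%:R^-1%:C *: 1%:M : 'M[C]_nt) = (kappa ^+ 2 / nt%:R)%:C *: 1%:M.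
Proof.
apply/matrixP => i j; rewrite UpsilonE !mxE ups_admissible; last exact: isotropic_admissible.
rewrite !mxE eqxx mulr1 mulr_natr /=; congr (_ *+ _); congr (_ %:C).
by field; rewrite gt_eqF.
Qed.

Lemma Upsilon_alpha1 Q : alpha = 1 -> admissible Q ->
  Upsilon kappa alpha Q = (kappa ^+ 2 / nt%:R)%:C *: 1%:M.
Proof.
move=> a1 aQ; apply/matrixP => i j; rewrite UpsilonE !mxE ups_admissible//.
by rewrite a1 subrr mul0r add0r mul1r mulr_natr.
Qed.

(* Equal power on the row space of [H]. *)
Lemma row_space_covariance H : (0 < \rank H)%N -> exists Q, admissible Q /\
  H *m Q *m hermT H = (\rank H)%:R^-1%:C *: (H *m hermT H).
Proof.
move=> r0; have [E [K [c [_ pK [L eH] _]]]] := gmi_compress H.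
have rR : 0 < (\rank H)%:R :> R by rewrite ltr0n.
(* [K^H (K K^H)^-1 K] is an orthogonal projector of trace [rank H]. *)
exists ((\rank H)%:R^-1%:C *: (hermT K *m invmx (K *m hermT K) *m K)); split.
  split.
    apply: psdZ; first by rewrite invr_ge0 ltW.
    rewrite -[X in _ *m X]hermTK; apply: psd_congr; exact: (pd_inv pK).1.
  rewrite linearZ /= -mulmxA mxtrace_mulC -mulmxA (mulVmx pK.2) mxtrace1.
  by rewrite -(rmorph_nat (real_complex R)) -rmorphM mulVf// gt_eqF.
rewrite congrZ; congr (_ *: _).
have key m (M : 'M[C]_(m, nt)) (N : 'M[C]_(nr, m)) : pd (M *m hermT M) ->
    N *m M *m (hermT M *m invmx (M *m hermT M) *m M) *m hermT (N *m M)
    = N *m M *m hermT (N *m M).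
  move=> pM; rewrite hermT_mul.
  have -> : N *m M *m (hermT M *m invmx (M *m hermT M) *m M) *m (hermT M *m hermT N)
     = N *m ((M *m hermT M) *m invmx (M *m hermT M) *m (M *m hermT M)) *m hermT N.
    by rewrite !mulmxA.
  by rewrite (mulmxV pM.2) mul1mx !mulmxA.
by have := key _ K L pK; rewrite -eH.
Qed.

End OneChannel.
End DistortedChannel.

(** * Measurability of complex matrix-valued functions *)

Section ComplexMeasurability.
Variable R : realType.
Local Notation C := R[i].
Variables (d : measure_display) (T : measurableType d).

(** Stated on real and imaginary parts, the form in which [channel_ok] provides measurability. *)
Definition cmeas (f : T -> C) :=
  measurable_fun setT (fun w => complex.Re (f w)) /\
  measurable_fun setT (fun w => complex.Im (f w)).

Definition mmeas m n (A : T -> 'M[C]_(m, n)) := forall i j, cmeas (fun w => A w i j).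

Lemma cmeas_cst c : cmeas (fun=> c).
Proof. by split; exact: measurable_cst. Qed.

Lemma cmeasD f g : cmeas f -> cmeas g -> cmeas (fun w => f w + g w).
Proof.
move=> [f1 f2] [g1 g2]; split.
  apply: (eq_measurable_fun ((fun w => complex.Re (f w)) \+ (fun w => complex.Re (g w)))).
    by move=> w _ /=; rewrite reD.
  exact: measurable_funD.
apply: (eq_measurable_fun ((fun w => complex.Im (f w)) \+ (fun w => complex.Im (g w)))).
  by move=> w _ /=; case: (f w); case: (g w).
exact: measurable_funD.
Qed.

Lemma cmeasM f g : cmeas f -> cmeas g -> cmeas (fun w => f w * g w).
Proof.
move=> [f1 f2] [g1 g2]; split.
  apply: (eq_measurable_fun
    (((fun w => complex.Re (f w)) \* (fun w => complex.Re (g w))) \-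
     ((fun w => complex.Im (f w)) \* (fun w => complex.Im (g w))))).
    by move=> w _ /=; case: (f w); case: (g w).
  by apply: measurable_funB; exact: measurable_funM.
apply: (eq_measurable_fun
    (((fun w => complex.Re (f w)) \* (fun w => complex.Im (g w))) \+
     ((fun w => complex.Im (f w)) \* (fun w => complex.Re (g w))))).
  by move=> w _ /=; case: (f w) => a b; case: (g w) => x y.
by apply: measurable_funD; exact: measurable_funM.
Qed.

Lemma cmeas_conj f : cmeas f -> cmeas (fun w => conjc (f w)).
Proof.
move=> [f1 f2]; split.
  by apply: (eq_measurable_fun _ _ f1) => w _ /=; case: (f w).
apply: (eq_measurable_fun (\- (fun w => complex.Im (f w)))).
  by move=> w _ /=; case: (f w).
exact: measurable_funN.
Qed.

Lemma cmeas_sum (I : Type) (r : seq I) (F : I -> T -> C) :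
  (forall i, cmeas (F i)) -> cmeas (fun w => \sum_(i <- r) F i w).
Proof.
move=> mF; elim: r => [|i r IH].
  by under eq_fun do rewrite big_nil; exact: cmeas_cst.
by under eq_fun do rewrite big_cons; exact: cmeasD.
Qed.

Lemma cmeas_prod (I : Type) (r : seq I) (F : I -> T -> C) :
  (forall i, cmeas (F i)) -> cmeas (fun w => \prod_(i <- r) F i w).
Proof.
move=> mF; elim: r => [|i r IH].
  by under eq_fun do rewrite big_nil; exact: cmeas_cst.
by under eq_fun do rewrite big_cons; exact: cmeasM.
Qed.

Lemma mmeas_cst m n (A : 'M[C]_(m, n)) : mmeas (fun=> A).
Proof. by move=> i j; exact: cmeas_cst. Qed.

Lemma mmeasD m n (A B : T -> 'M[C]_(m, n)) : mmeas A -> mmeas B ->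
  mmeas (fun w => A w + B w).
Proof. by move=> mA mB i j; under eq_fun do rewrite mxE; exact: cmeasD. Qed.

Lemma mmeas_mul m n p (A : T -> 'M[C]_(m, n)) (B : T -> 'M[C]_(n, p)) :
  mmeas A -> mmeas B -> mmeas (fun w => A w *m B w).
Proof.
move=> mA mB i j; under eq_fun do rewrite mxE.
by apply: cmeas_sum => k; exact: cmeasM.
Qed.

Lemma mmeasZ m n (c : C) (A : T -> 'M[C]_(m, n)) : mmeas A ->
  mmeas (fun w => c *: A w).
Proof.
move=> mA i j; under eq_fun do rewrite mxE.
by apply: cmeasM => //; exact: cmeas_cst.
Qed.

Lemma mmeas_hermT m n (A : T -> 'M[C]_(m, n)) : mmeas A ->
  mmeas (fun w => hermT (A w)).
Proof. by move=> mA i j; under eq_fun do rewrite hermTE; exact: cmeas_conj. Qed.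

Lemma cmeas_det n (A : T -> 'M[C]_n) : mmeas A -> cmeas (fun w => \det (A w)).
Proof.
move=> mA; rewrite /determinant; apply: cmeas_sum => s.
by apply: cmeasM; [exact: cmeas_cst | apply: cmeas_prod => i; exact: mA].
Qed.

Lemma cmeas_trace n (A : T -> 'M[C]_n) : mmeas A -> cmeas (fun w => \tr (A w)).
Proof. by move=> mA; apply: cmeas_sum => i; exact: mA. Qed.

Lemma measurable_ldet n (A : T -> 'M[C]_n) : mmeas A ->
  measurable_fun setT (fun w => ldet (A w)).
Proof.
move=> /cmeas_det[m1 _].
exact: (measurableT_comp (@measurable_ln R) m1).
Qed.

Section Channel.
Variables (nr nt : nat) (H : T -> 'M[C]_(nr, nt)).
Hypothesis mH : mmeas H.

Lemma mmeas_congr X : mmeas (fun w => H w *m X *m hermT (H w)).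
Proof.
apply: mmeas_mul; last exact: mmeas_hermT.
by apply: mmeas_mul => //; exact: mmeas_cst.
Qed.

Lemma measurable_gmi s X : measurable_fun setT (fun w => gmi s (H w) X).
Proof.
apply: measurable_ldet; apply: mmeasD; first exact: mmeas_cst.
by apply: mmeasZ; exact: mmeas_congr.
Qed.

Lemma measurable_wtr X : measurable_fun setT (fun w => wtr (H w) X).
Proof. by have [] := cmeas_trace (mmeas_congr X). Qed.

Lemma measurable_frob2 : measurable_fun setT (fun w => frob2 (H w)).
Proof.
have := measurable_wtr 1%:M; congr (measurable_fun _ _); apply/funext => w.
by rewrite /wtr mulmx1 tr_mul_hermT.
Qed.

End Channel.
End ComplexMeasurability.

(** * Integrability and expectation of real random variables *)

Section Expectation.
Variable R : realType.
Variables (d : measure_display) (T : measurableType d) (P : probability T R).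

Definition integ (f : T -> R) := P.-integrable setT (EFin \o f).

Definition EE (f : T -> R) : R := \int[P]_w f w.

Lemma integ_meas f : integ f -> measurable_fun setT f.
Proof. by move=> /integrableP[/measurable_EFinP]. Qed.

Lemma integ_EFin f : integ f -> (\int[P]_w (f w)%:E)%E = (EE f)%:E.
Proof. by move=> h; rewrite /EE /Rintegral fineK//; exact: integrable_fin_num. Qed.

Lemma integ_le (f g : T -> R) : measurable_fun setT f -> integ g ->
  (forall w, `|f w| <= g w) -> integ f.
Proof.
move=> mf ig h; apply: (le_integrable _ _ _ ig) => //.
  exact/measurable_EFinP.
by move=> w _ /=; rewrite lee_fin (le_trans (h w))// ler_norm.
Qed.

Lemma integ_cst k : integ (fun=> k).
Proof. exact: finite_measure_integrable_cst. Qed.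

Lemma integD f g : integ f -> integ g -> integ (fun w => f w + g w).
Proof. by move=> h1 h2; exact: (integrableD measurableT h1 h2). Qed.

Lemma integB f g : integ f -> integ g -> integ (fun w => f w - g w).
Proof. by move=> h1 h2; exact: (integrableB measurableT h1 h2). Qed.

Lemma integZ k f : integ f -> integ (fun w => k * f w).
Proof. by move=> h; exact: (integrableZl measurableT k h). Qed.

Lemma EED f g : integ f -> integ g -> EE (fun w => f w + g w) = EE f + EE g.
Proof. by move=> h1 h2; exact: RintegralD. Qed.

Lemma EEB f g : integ f -> integ g -> EE (fun w => f w - g w) = EE f - EE g.
Proof. by move=> h1 h2; exact: RintegralB. Qed.

Lemma EEZ k f : integ f -> EE (fun w => k * f w) = k * EE f.
Proof. by move=> h; exact: RintegralZl. Qed.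

Lemma EE_cst k : EE (fun=> k) = k.
Proof.
transitivity (k * fine (P setT)); first exact: Rintegral_cst.
by rewrite probability_setT mulr1.
Qed.

Lemma EE_le f g : integ f -> integ g -> (forall w, f w <= g w) -> EE f <= EE g.
Proof. by move=> h1 h2 h; apply: le_Rintegral => // w _; exact: h. Qed.

(** Replace [f] by the minimum of [f] and [g], which equals it almost everywhere and lies below [g]
    everywhere. *)
Lemma EE_le_ae f g : integ f -> integ g -> {ae P, forall w, f w <= g w} ->
  EE f <= EE g.
Proof.
move=> h1 h2 h.
have mm : measurable_fun setT (f \min g) by apply: measurable_minr; exact: integ_meas.
have i1 : integ (fun w => `|f w| + `|g w|).
  by apply: integD; [exact: (integrable_abse h1) | exact: (integrable_abse h2)].
have im : integ (f \min g).
  apply: (integ_le mm i1) => w /=.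
  by rewrite /Num.min; case: ifP => _; rewrite ?lerDl ?lerDr.
have -> : EE f = EE (f \min g).
  rewrite /EE /Rintegral; congr fine; apply: ae_eq_integral => //.
  - by apply/measurable_EFinP; exact: integ_meas.
  - exact/measurable_EFinP.
  - apply: filterS h => w fg _ /=; congr EFin.
    by rewrite /Num.min; case: ltP => // gf; apply/eqP; rewrite eq_le fg gf.
by apply: EE_le => // w /=; rewrite ge_min lexx orbT.
Qed.

Lemma EE_dct (f : nat -> T -> R) (g G : T -> R) :
  (forall n, measurable_fun setT (f n)) -> measurable_fun setT g -> integ G ->
  (forall n w, `|f n w| <= G w) ->
  {ae P, forall w, f n w @[n --> \oo] --> g w} ->
  EE (f n) @[n --> \oo] --> EE g.
Proof.
move=> mf mg iG fG fg.
have mfE n : measurable_fun setT (fun w => (f n w)%:E) by exact/measurable_EFinP.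
have mgE : measurable_fun setT (fun w => (g w)%:E) by exact/measurable_EFinP.
have cvE : {ae P, forall w, setT w -> (f n w)%:E @[n --> \oo] --> (g w)%:E}.
  by apply: filterS fg => w fw _; apply: cvg_EFin => //; exact: nearW.
have bdE : {ae P, forall w, forall n : nat, setT w -> (`|(f n w)%:E| <= (G w)%:E)%E}.
  by apply: aeW => w n _; rewrite lee_fin.
have [ig _ h] := dominated_convergence measurableT mfE mgE cvE iG bdE.
rewrite (integ_EFin ig) in h.
exact: (fine_cvg h).
Qed.

End Expectation.

(** * Equality in law and equality of expectations *)

Section LawInvariance.
Variable R : realType.
Local Notation C := R[i].
Variables (nr nt : nat).
(** A copy of the matrix type carrying a base point, on which the sigma-algebra generated by
    [mx_gen] can be placed. *)
Definition mxp := 'M[C]_(nr, nt).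
HB.instance Definition _ := Choice.on mxp.
HB.instance Definition _ := isPointed.Build mxp (0 : 'M[C]_(nr, nt)).
Local Notation mxG := (g_sigma_algebraType (@mx_gen R nr nt : set (set mxp))).

(** Seen as a random matrix, the identity turns measurability results for channels into
    measurability of functions of the matrix itself. *)
Lemma mmeas_mxG : mmeas (T := mxG) (fun A => A : 'M[C]_(nr, nt)).
Proof.
move=> i j; split=> _ B mB; rewrite setTI; apply: sub_sigma_algebra;
  exists i, j, B; split=> //; [left|right]; exact: erefl.
Qed.

Variables (d : measure_display) (T : measurableType d) (P : probability T R).

Lemma measurable_to_mxG (H : T -> 'M[C]_(nr, nt)) : mmeas H ->
  measurable_fun setT (H : T -> mxG).
Proof.
move=> mH; apply: (@measurability _ _ _ mxG setT H (@mx_gen R nr nt)) => //.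
move=> _ [_ [i [j [B [mB [->|->]]]]] <-]; have [h1 h2] := mH i j.
  exact: h1.
exact: h2.
Qed.

(** Both sides are integrals of [phi] against pushforward measures that agree on the
    sigma-algebra. *)
Lemma law_eq_EE (H1 H2 : T -> 'M[C]_(nr, nt)) (phi : 'M[C]_(nr, nt) -> R) :
  mmeas H1 -> mmeas H2 -> law_eq P H1 H2 ->
  measurable_fun setT (phi : mxG -> R) -> (forall A, 0 <= phi A) ->
  EE P (fun w => phi (H1 w)) = EE P (fun w => phi (H2 w)).
Proof.
move=> m1 m2 l12 mphi phi0; rewrite /EE /Rintegral; congr fine.
have mp : measurable_fun setT (fun A : mxG => (phi A)%:E) by exact/measurable_EFinP.
have p0 : {in setT, forall y : mxG, (0 <= (phi y)%:E)%E}.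
  by move=> y _; rewrite lee_fin.
have h1 := ge0_integral_pushforward (measurable_to_mxG m1) P measurableT mp p0.
have h2 := ge0_integral_pushforward (measurable_to_mxG m2) P measurableT mp p0.
rewrite !preimage_setT in h1 h2.
apply: (etrans (esym h1)); apply: (etrans _ h2).
apply: eq_measure_integral; [exact: measurable_to_mxG |
  exact: measurable_to_mxG | by move=> ? ? A mA _; exact: l12].
Qed.

End LawInvariance.

(** * Limits of suprema depending on a parameter *)

Section SupLimits.
Variable R : realType.
Variables (X : Type) (adm : set X) (f : R -> X -> R).
Hypothesis adm0 : adm !=set0.

Definition supf s := sup [set f s Q | Q in adm].

Lemma ler_supf s Q B : (forall Q, adm Q -> f s Q <= B) -> adm Q -> f s Q <= supf s.
Proof.
move=> fB aQ; apply: ub_le_sup; last by exists Q.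
by exists B => _ [Q' aQ' <-]; exact: fB.
Qed.

Lemma supf_le s B : (forall Q, adm Q -> f s Q <= B) -> supf s <= B.
Proof.
move=> fB; apply: ge_sup; last by move=> _ [Q aQ <-]; exact: fB.
by case: adm0 => Q aQ; exists (f s Q), Q.
Qed.

Lemma cvg_supf_slope (l : X -> R) (L : R) :
  (forall Q, adm Q -> l Q <= L) ->
  (forall s Q, 0 < s -> adm Q -> f s Q <= s * l Q) ->
  (forall Q e, adm Q -> 0 < e ->
    exists2 s0, 0 < s0 & forall s, 0 < s -> s <= s0 -> s * (l Q - e) <= f s Q) ->
  supf s / s @[s --> 0^'+] --> sup [set l Q | Q in adm].
Proof.
move=> lL fle fge; set lam := sup _.
have hs : has_sup [set l Q | Q in adm].
  split; first by case: adm0 => Q aQ; exists (l Q), Q.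
  by exists L => _ [Q aQ <-]; exact: lL.
have llam Q : adm Q -> l Q <= lam by move=> aQ; apply: ub_le_sup; [exact: hs.2 | exists Q].
have fslam s Q : 0 < s -> adm Q -> f s Q <= s * lam.
  by move=> s0 aQ; rewrite (le_trans (fle _ _ s0 aQ))// ler_pM2l// llam.
apply/cvgrPdist_le => e e0.
have e2 : 0 < e / 2 by rewrite divr_gt0.
have [_ [Q aQ <-] hQ] := sup_adherent e2 hs.
have [s0 s00 hs0] := fge Q (e / 2) aQ e2.
near=> s.
have sp : 0 < s by near: s; exact: nbhs_right_gt.
have ss0 : s <= s0 by near: s; exact: nbhs_right_ltW.
have h1 : supf s <= s * lam by apply: supf_le => Q' aQ'; exact: fslam.
have h2 : s * (l Q - e / 2) <= supf s.
  by apply: le_trans (hs0 s sp ss0) (ler_supf _ aQ) => Q'; exact: fslam.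
have h3 : supf s / s <= lam by rewrite ler_pdivrMr// mulrC.
have h4 : l Q - e / 2 <= supf s / s by rewrite ler_pdivlMr// mulrC.
have h5 : lam - e / 2 < l Q := hQ.
have h6 : supf s / s <= lam + 0 by rewrite addr0.
rewrite ger0_norm ?subr_ge0//.
by move: h4 h5; clear; lra.
Unshelve. all: by end_near. Qed.

Definition supsup := sup [set f sQ.1 sQ.2 | sQ in [set sQ : R * X | 0 < sQ.1 /\ adm sQ.2]].

Variable B : R.
Hypothesis fB : forall s Q, 0 < s -> adm Q -> f s Q <= B.

Lemma has_sup_supsup :
  has_sup [set f sQ.1 sQ.2 | sQ in [set sQ : R * X | 0 < sQ.1 /\ adm sQ.2]].
Proof.
split; first by case: adm0 => Q aQ; exists (f 1 Q), (1, Q) => //=; rewrite ltr01.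
by exists B => _ [[s Q] /= [s0 aQ] <-]; exact: fB.
Qed.

Lemma ler_supsup s Q : 0 < s -> adm Q -> f s Q <= supsup.
Proof.
by move=> s0 aQ; apply: ub_le_sup; [exact: has_sup_supsup.2 | exists (s, Q)].
Qed.

Lemma supsup_le B' : (forall s Q, 0 < s -> adm Q -> f s Q <= B') -> supsup <= B'.
Proof.
move=> h; apply: ge_sup; first exact: has_sup_supsup.1.
by move=> _ [[s Q] /= [s0 aQ] <-]; exact: h.
Qed.

(** Beyond the [s0] of a nearly optimal pair [(s0, Q)], monotonicity keeps [supf s] within [e] of
    the joint supremum. *)
Lemma cvg_supf_pinfty :
  (forall s s' Q, 0 < s -> s <= s' -> adm Q -> f s Q <= f s' Q) ->
  supf s @[s --> +oo] --> supsup.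
Proof.
move=> fmono; apply/cvgrPdist_le => e e0.
have [_ [[s0 Q] /= [s00 aQ] <-] hQ] := sup_adherent e0 has_sup_supsup.
near=> s.
have ss0 : s0 <= s by near: s; apply: nbhs_pinfty_ge; exact: num_real.
have sp : 0 < s by exact: lt_le_trans ss0.
have h1 : supf s <= supsup by apply: supf_le => Q' aQ'; exact: ler_supsup.
have h2 : f s0 Q <= supf s.
  by apply: le_trans (fmono _ _ _ s00 ss0 aQ) (ler_supf _ aQ) => Q'; exact: fB.
have h5 : supsup - e < f s0 Q := hQ.
rewrite ger0_norm ?subr_ge0//.
by move: h2 h5; clear; lra.
Unshelve. all: by end_near. Qed.

End SupLimits.

(** * Comparison of integrals *)

Section NonnegIntegral.
Variable R : realType.
Variables (d : measure_display) (T : measurableType d) (P : probability T R).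

(* Unlike [ge0_le_integral], no measurability is needed: the integral of a
   nonnegative function is a supremum over the simple functions below it. *)
Lemma ge0_le_integral_nomeas (f g : T -> \bar R) : (forall w, 0 <= f w)%E ->
  (forall w, f w <= g w)%E -> (\int[P]_w f w <= \int[P]_w g w)%E.
Proof.
move=> f0 fg; have g0 w : (0 <= g w)%E by exact: le_trans (fg w).
rewrite !ge0_integralTE//; apply: ge_ereal_sup => _ [h hf <-].
by apply: ereal_sup_ubound; exists h => //= w; exact: le_trans (fg w).
Qed.

Lemma EE_ae_cst (f : T -> R) k : integ P f -> {ae P, forall w, f w = k} -> EE P f = k.
Proof.
move=> jf h; have jk := integ_cst P k; apply/eqP; rewrite eq_le.
rewrite -(EE_cst P k); apply/andP; split; apply: EE_le_ae => //.
  by apply: filterS h => w ->.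
by apply: filterS h => w ->.
Qed.

Lemma EE_convex (f g k : T -> R) (t : R) : integ P f -> integ P g -> integ P k ->
  (forall w, t * f w + (1 - t) * g w <= k w) ->
  t * EE P f + (1 - t) * EE P g <= EE P k.
Proof.
move=> jf jg jk h; have h1 := integZ t jf; have h2 := integZ (1 - t) jg.
by rewrite -(EEZ t jf) -(EEZ (1 - t) jg) -(EED h1 h2); apply: EE_le => //; exact: integD.
Qed.

End NonnegIntegral.

(** * Concavity of the mutual information in the covariance *)

Section Concavity.
Variable R : realType.
Local Notation C := R[i].
Local Notation re := (@complex.Re R).

Lemma herm_diag_real n (A : 'M[C]_n) k : hermT A = A -> A k k = (re (A k k))%:C.
Proof.
move=> hA; have := congr1 (fun B : 'M[C]_n => B k k) hA; rewrite hermTE.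
case: (A k k) => x y [h]; apply/eqP; rewrite eq_complex /= eqxx /=.
by apply/eqP; lra.
Qed.

(** Bound both values by the tangent at [Z]; the linear terms cancel because [Z] is the weighted
    mean. *)
Lemma ldet_concave n (X Y Z : 'M[C]_n) (t : R) : 0 <= t <= 1 ->
  pd X -> pd Y -> pd Z -> Z = t%:C *: X + (1 - t)%:C *: Y ->
  t * ldet X + (1 - t) * ldet Y <= ldet Z.
Proof.
move=> /andP[t0 t1] pX pY pZ eZ.
have h1 := ler_wpM2l t0 (tangent pX pZ).
have t1' : 0 <= 1 - t by rewrite subr_ge0.
have h2 := ler_wpM2l t1' (tangent pY pZ).
set a := re _ in h1; set b := re _ in h2.
have ab : t * a + (1 - t) * b = 0.
  rewrite /a /b -!re_trZ -re_trD !scalemxAr -mulmxDr.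
  have -> : t%:C *: (X - Z) + (1 - t)%:C *: (Y - Z) = 0.
    rewrite !scalerBr addrACA -eZ -opprD -scalerDl -rmorphD addrC.
    by rewrite [t + _]addrC subrK rmorph1 scale1r addNr.
  by rewrite mulmx0 linear0.
apply: (le_trans (lerD h1 h2)).
by rewrite !mulrDr addrACA ab addr0 -mulrDl addrC subrK mul1r.
Qed.

Lemma gmi_concave nr nt s (H : 'M[C]_(nr, nt)) A B (t : R) : 0 <= t <= 1 ->
  0 <= s -> psd A -> psd B ->
  t * gmi s H A + (1 - t) * gmi s H B <= gmi s H (t%:C *: A + (1 - t)%:C *: B).
Proof.
move=> t01 s0 pA pB; have /andP[t0 t1] := t01.
have pAB : psd (t%:C *: A + (1 - t)%:C *: B).
  by apply: psdD; [exact: psdZ | apply: (psdZ _ pB); rewrite subr_ge0].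
apply: (ldet_concave t01 (pd_gmi H s0 pA) (pd_gmi H s0 pB) (pd_gmi H s0 pAB)).
rewrite congrD !congrZ !scalerDr !scalerA addrACA -scalerDl -rmorphD addrC.
by rewrite [t + _]addrC subrK rmorph1 scale1r [1%:M + _]addrC ![_ * s%:C]mulrC addrC.
Qed.

Lemma gmi_mulr nr nt s (H : 'M[C]_(nr, nt)) (U X : 'M[C]_nt) :
  gmi s (H *m U) X = gmi s H (U *m X *m hermT U).
Proof. by rewrite /gmi hermT_mul !mulmxA. Qed.

Lemma wtr_mulr nr nt (H : 'M[C]_(nr, nt)) (U X : 'M[C]_nt) :
  wtr (H *m U) X = wtr H (U *m X *m hermT U).
Proof. by rewrite /wtr hermT_mul !mulmxA. Qed.

End Concavity.

(** * Capacity of a random channel and its limits *)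

Section System.
Variable R : realType.
Local Notation C := R[i].
Local Notation re := (@complex.Re R).
Variables (d : measure_display) (T : measurableType d) (P : probability T R).
Variables (nr nt : nat) (H : T -> 'M[C]_(nr, nt)) (kappa alpha : R).
Hypothesis nt0 : (0 < nt)%N.
Hypothesis nr0 : (0 < nr)%N.
Hypothesis kappa0 : 0 < kappa.
Hypothesis alpha01 : 0 <= alpha <= 1.
Hypothesis mH : mmeas H.
Hypothesis iF : integ P (fun w => frob2 (H w)).
Hypothesis rankH : {ae P, forall w, \rank (H w) = minn nt nr}.

Local Notation M := (minn nt nr).
Local Notation Y Q := (Upsilon kappa alpha Q).
Let adm : set 'M[C]_nt := [set Q | admissible Q].

Let k2 : 0 < kappa ^+ 2. Proof. exact: exprn_gt0. Qed.
Let M0 : (0 < M)%N. Proof. by rewrite leq_min nt0. Qed.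
Let ntR : 0 < nt%:R :> R. Proof. by rewrite ltr0n. Qed.
Let ln2 : 0 < ln 2 :> R. Proof. by rewrite ln_gt0// ltr1n. Qed.

Lemma adm_neq0 : adm !=set0.
Proof. by eexists; exact: (isotropic_admissible _ nt0). Qed.

Lemma integ_wtr X : psd X -> integ P (fun w => wtr (H w) X).
Proof.
move=> pX; apply: (integ_le (measurable_wtr mH X) (integZ (re (\tr X)) iF)) => w.
by rewrite (ger0_norm (wtr_ge0 (H w) pX)); exact: wtr_le_frob2.
Qed.

Lemma integ_gmi s X : 0 <= s -> psd X -> integ P (fun w => gmi s (H w) X).
Proof.
move=> s0 pX; apply: (integ_le (measurable_gmi mH s X) (integZ s (integ_wtr pX))) => w.
by rewrite (ger0_norm (gmi_ge0 (H w) s0 pX)); exact: gmi_le_wtr.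
Qed.

(** The mutual information, in nats, for the realization [H w]. *)
Definition diff s Q w := gmi s (H w) (Q + Y Q) - gmi s (H w) (Y Q).

Lemma psdQY Q : adm Q -> psd (Q + Y Q).
Proof. by move=> aQ; apply: psdD; [exact: aQ.1 | exact: psd_Upsilon]. Qed.

Lemma integ_diff s Q : 0 <= s -> adm Q -> integ P (diff s Q).
Proof.
move=> s0 aQ; apply: integB; apply: integ_gmi => //; first exact: psdQY.
exact: psd_Upsilon.
Qed.

Lemma diff_ge0 s Q w : 0 <= s -> adm Q -> 0 <= diff s Q w.
Proof.
move=> s0 aQ; rewrite subr_ge0; apply: (gmi_mono _ s0); first exact: psd_Upsilon.
by rewrite addrK; exact: aQ.1.
Qed.

Definition mean_rate s Q := EE P (diff s Q) / ln 2.

Lemma integral_rate s Q : 0 <= s -> adm Q ->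
  (\int[P]_w (rate kappa alpha s Q (H w))%:E)%E = (mean_rate s Q)%:E.
Proof.
move=> s0 aQ; rewrite /mean_rate mulrC -EEZ; last exact: integ_diff.
rewrite -(integ_EFin (integZ _ (integ_diff s0 aQ))).
apply: eq_integral => w _; congr EFin; rewrite mulrC.
by apply: (gmi_rate _ s0 aQ.1); exact: psd_Upsilon.
Qed.

Definition cap := supf adm mean_rate.

Let EF := EE P (fun w => frob2 (H w)).

Definition wmean Q := EE P (fun w => wtr (H w) Q).

Lemma wmean_le Q : adm Q -> wmean Q <= EF.
Proof.
move=> aQ; apply: EE_le => [||w]; [exact: integ_wtr aQ.1|exact: iF|].
by apply: (le_trans (wtr_le_frob2 _ aQ.1)); rewrite aQ.2 /= mul1r.
Qed.

Lemma mean_rate_le_wmean s Q : 0 < s -> adm Q -> mean_rate s Q <= s * (wmean Q / ln 2).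
Proof.
move=> s0 aQ; rewrite mulrA ler_pM2r ?invr_gt0// -(EEZ _ (integ_wtr aQ.1)).
apply: EE_le => [||w]; [exact: integ_diff (ltW s0) aQ|exact: integZ (integ_wtr aQ.1)|].
apply: gmi_diff_le; [exact: ltW|exact: aQ.1|exact: psd_Upsilon].
Qed.

Lemma mean_rate_le_EF s Q : 0 < s -> adm Q -> mean_rate s Q <= s * (EF / ln 2).
Proof.
move=> s0 aQ; apply: (le_trans (mean_rate_le_wmean s0 aQ)).
by rewrite ler_pM2l// ler_pM2r ?invr_gt0//; exact: wmean_le.
Qed.

(** The bound linear in [s] keeps the mean rates bounded, so their extended supremum is a real
    number. *)
Lemma capacityE s : 0 < s -> capacity P H kappa alpha s = (cap s)%:E.
Proof.
move=> s0; rewrite /cap /supf -ereal_sup_EFin; last 2 first.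
- by exists (s * (EF / ln 2)) => _ [Q aQ <-]; exact: mean_rate_le_EF.
- by case: adm_neq0 => Q aQ; exists (mean_rate s Q), Q.
rewrite /capacity; congr ereal_sup; apply/seteqP; split=> x /=.
  move=> [Q aQ <-]; exists (mean_rate s Q); first by exists Q.
  by rewrite integral_rate// ltW.
by move=> [_ [Q aQ <-] <-]; exists Q => //; rewrite integral_rate// ltW.
Qed.

Lemma diff_nondecreasing s s' Q w : 0 < s -> s <= s' -> adm Q ->
  diff s Q w <= diff s' Q w.
Proof.
move=> s0 ss' aQ; apply: gmi_diff_nondecreasing => //; first exact: aQ.1.
exact: psd_Upsilon.
Qed.

Lemma mean_rate_nondecreasing s s' Q : 0 < s -> s <= s' -> adm Q ->
  mean_rate s Q <= mean_rate s' Q.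
Proof.
move=> s0 ss' aQ; have s'0 := lt_le_trans s0 ss'.
rewrite /mean_rate; apply: ler_wpM2r; first by rewrite invr_ge0 ltW.
apply: EE_le => [||w]; [exact: integ_diff (ltW s0) aQ|exact: integ_diff (ltW s'0) aQ|].
exact: diff_nondecreasing.
Qed.

(** [upoo] and [lowoo] bound the limiting capacity itself; dividing by the single-antenna limit
    [log2 (1 + 1 / kappa ^+ 2)] gives the bounds on the multiplexing gain. *)
Definition upoo := M%:R * log2 (1 + nt%:R / (M%:R * kappa ^+ 2)).
Definition lowoo := M%:R * log2 (1 + 1 / kappa ^+ 2).

Lemma mean_rate_le_upoo s Q : 0 < s -> adm Q -> mean_rate s Q <= upoo.
Proof.
move=> s0 aQ; rewrite /upoo /log2 mulrA ler_pM2r ?invr_gt0//.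
rewrite -(EE_cst P (M%:R * _)); apply: EE_le_ae.
- exact: integ_diff (ltW s0) aQ.
- exact: integ_cst.
apply: filterS rankH => w rw; rewrite -rw.
by apply: gmi_diff_le_full => //; [exact: ltW | rewrite rw].
Qed.

Definition caplim := supsup adm mean_rate.

Lemma cvg_cap : cap s @[s --> +oo] --> caplim.
Proof.
apply: (cvg_supf_pinfty adm_neq0 mean_rate_le_upoo).
by move=> s s' Q; exact: mean_rate_nondecreasing.
Qed.

Lemma caplim_le_upoo : caplim <= upoo.
Proof. by apply: (supsup_le adm_neq0); exact: mean_rate_le_upoo. Qed.

(** [lam / ln 2] is the slope of the capacity at zero SNR. *)
Definition lam := sup [set wmean Q | Q in adm].

Lemma wmean_le_lam Q : adm Q -> wmean Q <= lam.
Proof.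
move=> aQ; apply: ub_le_sup; last by exists Q.
by exists EF => _ [Q' aQ' <-]; exact: wmean_le.
Qed.

Lemma lam_le B : (forall Q, adm Q -> wmean Q <= B) -> lam <= B.
Proof.
move=> h; apply: ge_sup; first by case: adm_neq0 => Q aQ; exists (wmean Q), Q.
by move=> _ [Q aQ <-]; exact: h.
Qed.

(* Dominated convergence in [wtr / (1 + s (1 + kappa^2) frob2)]. *)
Lemma mean_rate_ge Q e : adm Q -> 0 < e ->
  exists2 s0, 0 < s0 & forall s, 0 < s -> s <= s0 ->
    s * (wmean Q / ln 2 - e) <= mean_rate s Q.
Proof.
move=> aQ e0; set c := 1 + kappa ^+ 2.
have c0 : 0 < c by rewrite addr_gt0.
pose q s w := wtr (H w) Q / (1 + s * (c * frob2 (H w))).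
have W0 w : 0 <= wtr (H w) Q := wtr_ge0 _ aQ.1.
have D1 s w : 0 <= s -> 1 <= 1 + s * (c * frob2 (H w)).
  by move=> s0; rewrite lerDl mulr_ge0// mulr_ge0 ?(ltW c0)// frob2_ge0.
have qW s w : 0 <= s -> `|q s w| <= wtr (H w) Q.
  move=> s0; have D := D1 s w s0; have D' := lt_le_trans ltr01 D.
  rewrite ger0_norm; last by rewrite divr_ge0// ltW.
  by rewrite ler_pdivrMr// ler_peMr.
have mq s : 0 <= s -> measurable_fun setT (q s).
  move=> s0; pose D w := 1 + s * (c * frob2 (H w)).
  have mD : measurable_fun setT D.
    apply: measurable_funD; first exact: measurable_cst.
    apply: measurable_funM; first exact: measurable_cst.
    by apply: measurable_funM; [exact: measurable_cst | exact: integ_meas iF].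
  (* Since [D w >= 1], its inverse is [expR (- ln (D w))], a composition of measurable functions. *)
  apply: (eq_measurable_fun ((fun w => wtr (H w) Q) \* (fun w => expR (- ln (D w))))).
    by move=> w _ /=; rewrite expRN lnK// posrE (lt_le_trans ltr01 (D1 s w s0)).
  apply: measurable_funM; first exact: measurable_wtr.
  apply: (measurableT_comp (@measurable_expR R)); apply: measurable_funN.
  exact: (measurableT_comp (@measurable_ln R) mD).
have iq s : 0 <= s -> integ P (q s).
  by move=> s0; apply: (integ_le (mq s s0) (integ_wtr aQ.1)) => w; exact: qW.
have qdiff s w : 0 <= s -> s * q s w <= diff s Q w.
  move=> s0; have pY := psd_Upsilon kappa0 alpha01 aQ.
  apply: le_trans (gmi_diff_ge (H w) s0 aQ.1 pY).
  have -> : s * q s w = s * wtr (H w) Q * (1 + s * (c * frob2 (H w)))^-1.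
    exact: mulrA.
  rewrite ler_wpM2l//; first by rewrite mulr_ge0.
  have h1 : wtr (H w) (Q + Y Q) <= c * frob2 (H w).
    apply: (le_trans (wtr_le_frob2 _ (psdQY aQ))).
    by rewrite re_trD aQ.2 re_tr_Upsilon.
  have h0 : 0 <= wtr (H w) (Q + Y Q) := wtr_ge0 _ (psdQY aQ).
  rewrite lef_pV2 ?posrE; first by rewrite lerD2l ler_wpM2l.
    exact: lt_le_trans ltr01 (D1 s w s0).
  by rewrite ltr_pwDl// mulr_ge0.
(* A sequence suffices: [q] decreases in [s], so a lower bound at [1 / (n + 1)] persists for every
   smaller [s]. *)
have cv : EE P (q (n.+1%:R^-1)) @[n --> \oo] --> wmean Q.
  apply: (EE_dct _ (measurable_wtr mH Q) (integ_wtr aQ.1)).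
  - by move=> n; apply: mq; rewrite invr_ge0.
  - by move=> n w; apply: qW; rewrite invr_ge0.
  apply: aeW => w; rewrite /q -[X in _ --> X]divr1.
  apply: cvgM; first exact: cvg_cst.
  apply: cvgV; first exact: oner_neq0.
  rewrite -[X in _ --> X]addr0; apply: cvgD; first exact: cvg_cst.
  rewrite -[X in _ --> X](mul0r (c * frob2 (H w))).
  by apply: cvgM; [exact: cvg_harmonic | exact: cvg_cst].
have el : 0 < e * ln 2 by rewrite mulr_gt0.
have /cvgrPdist_le /(_ _ el) [n _ hn] := cv.
exists n.+1%:R^-1; first by rewrite invr_gt0.
move=> s s0 sn; have h1 := hn n (leqnn n).
have h2 : wmean Q - e * ln 2 <= EE P (q n.+1%:R^-1).
  by move: h1; rewrite /= ler_distlC => /andP[]; lra.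
have h3 : EE P (q n.+1%:R^-1) <= EE P (q s).
  apply: EE_le => [||w]; [by apply: iq; rewrite invr_ge0|exact: iq (ltW s0)|].
  rewrite /q ler_wpM2l// lef_pV2 ?posrE.
  - by rewrite lerD2l ler_wpM2r// mulr_ge0 ?(ltW c0)// frob2_ge0.
  - by apply: lt_le_trans ltr01 (D1 _ w _); rewrite invr_ge0.
  - exact: lt_le_trans ltr01 (D1 _ w (ltW s0)).
have h4 : s * EE P (q s) <= EE P (diff s Q).
  rewrite -EEZ; last exact: iq (ltW s0).
  apply: EE_le => [||w]; [exact: integZ (iq _ (ltW s0))|exact: integ_diff (ltW s0) aQ|].
  exact: qdiff (ltW s0).
rewrite /mean_rate ler_pdivlMr// -mulrA mulrBl divfK ?gt_eqF//.
apply: le_trans h4; rewrite ler_pM2l//; exact: le_trans h2 h3.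
Qed.

Lemma cvg_cap_slope : cap s / s @[s --> 0^'+] --> lam / ln 2.
Proof.
have -> : lam / ln 2 = sup [set wmean Q / ln 2 | Q in adm].
  have il : 0 < (ln 2)^-1 :> R by rewrite invr_gt0.
  apply/eqP; rewrite eq_le; apply/andP; split.
    rewrite ler_pdivrMr//; apply: lam_le => Q aQ; rewrite -ler_pdivrMr//.
    apply: ub_le_sup; last by exists Q.
    by exists (EF / ln 2) => _ [Q' aQ' <-]; rewrite ler_pM2r//; exact: wmean_le.
  apply: ge_sup; first by case: adm_neq0 => Q aQ; exists (wmean Q / ln 2), Q.
  by move=> _ [Q aQ <-]; rewrite ler_pM2r//; exact: wmean_le_lam.
apply: (cvg_supf_slope adm_neq0 (L := EF / ln 2)).
- by move=> Q aQ; rewrite ler_pM2r ?invr_gt0//; exact: wmean_le.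
- by move=> s Q; exact: mean_rate_le_wmean.
- by move=> Q e; exact: mean_rate_ge.
Qed.

(** Measurability of [w |-> spec2 (H w)] is not established; bounds on this integral go through
    [ge0_le_integral_nomeas]. *)
Let e2 : \bar R := (\int[P]_w (spec2 (H w))%:E)%E.
Let E2 := fine e2.

Lemma e2_le_EF : (e2 <= EF%:E)%E.
Proof.
rewrite -(integ_EFin iF); apply: ge0_le_integral_nomeas => w.
  by rewrite lee_fin spec2_ge0.
by rewrite lee_fin spec2_le_frob2.
Qed.

Lemma e2_fin : e2 = E2%:E.
Proof.
rewrite fineK// ge0_fin_numE; first exact: le_lt_trans e2_le_EF (ltry _).
by apply: integral_ge0 => w _; rewrite lee_fin spec2_ge0.
Qed.

Lemma E2_le_EF : E2 <= EF.
Proof. by have := e2_le_EF; rewrite e2_fin lee_fin. Qed.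

Lemma lam_le_E2 : lam <= E2.
Proof.
apply: lam_le => Q aQ; rewrite -lee_fin -e2_fin -(integ_EFin (integ_wtr aQ.1)).
apply: ge0_le_integral_nomeas => w; rewrite lee_fin; first exact: wtr_ge0 aQ.1.
by have := wtr_le_spec2 (H w) aQ.1; rewrite aQ.2 /= mul1r.
Qed.

Lemma wmean_isotropic : wmean (nt%:R^-1%:C *: 1%:M) = EF / nt%:R.
Proof.
rewrite /wmean mulrC -EEZ//; congr (EE P _); apply/funext => w.
by rewrite wtrZ /wtr mulmx1 tr_mul_hermT.
Qed.

Lemma lam_ge : EF / nt%:R <= lam.
Proof. by rewrite -wmean_isotropic; apply: wmean_le_lam; exact: isotropic_admissible. Qed.

(** For isotropic input, signal plus distortion is [c] times distortion. The difference stays below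
    [M ln c] and almost surely tends to it, so dominated convergence applies. *)
Lemma lowoo_le_caplim : lowoo <= caplim.
Proof.
set Q0 : 'M[C]_nt := nt%:R^-1%:C *: 1%:M.
have aQ : adm Q0 := isotropic_admissible R nt0.
set c := 1 + 1 / kappa ^+ 2.
have c1 : 1 <= c by rewrite lerDl divr_ge0// ltW.
set y := kappa ^+ 2 / nt%:R; have y0 : 0 < y by rewrite divr_gt0.
have eY : Y Q0 = y%:C *: 1%:M by exact: Upsilon_isotropic.
have eQY : Q0 + Y Q0 = (c * y)%:C *: 1%:M.
  rewrite eY -scalerDl -rmorphD; congr (_%:C *: _); rewrite /c /y.
  by field; rewrite !gt_eqF.
have diff_iso_le s w : 0 <= s -> diff s Q0 w <= M%:R * ln c.
  move=> s0; have p1 : psd (y%:C *: 1%:M : 'M[C]_nt).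
    by apply: psdZ; [exact: ltW | exact: psd1].
  rewrite /diff eQY eY rmorphM -scalerA.
  apply: (le_trans (gmi_scale_le (H w) p1 s0 c1)).
  rewrite ler_wpM2r ?ln_ge0// ler_nat leq_min.
  by rewrite rank_leq_col rank_leq_row.
have cv : EE P (diff n.+1%:R Q0) @[n --> \oo] --> EE P (fun=> M%:R * ln c).
  apply: (EE_dct _ _ (integ_cst P (M%:R * ln c))).
  - by move=> n; apply: integ_meas; exact: integ_diff.
  - exact: measurable_cst.
  - move=> n w; rewrite ger0_norm; last exact: diff_ge0.
    exact: diff_iso_le.
  apply: filterS rankH => w rw.
  have [K0 hK] := gmi_scale_ge (H w) y0 c1.
  apply: (@squeeze_cvgr _ _ _ _ (fun n => M%:R * ln c - K0 * n.+1%:R^-1)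
     (fun=> M%:R * ln c)); last exact: cvg_cst.
  - apply: nearW => n; rewrite diff_iso_le// andbT /diff eQY eY -{1}rw.
    exact: hK.
  - rewrite -[X in _ --> X]subr0; apply: cvgB; first exact: cvg_cst.
    rewrite -[X in _ --> X](mulr0 K0); apply: cvgM; first exact: cvg_cst.
    exact: cvg_harmonic.
rewrite EE_cst in cv.
have cv2 : mean_rate n.+1%:R Q0 @[n --> \oo] --> lowoo.
  rewrite /lowoo /log2 mulrA; apply: cvgM; [exact: cv | exact: cvg_cst].
rewrite -(cvg_lim _ cv2)//; apply: limr_le; first by apply: cvgP cv2.
by apply: nearW => n; exact: (ler_supsup adm_neq0 mean_rate_le_upoo (ltr0Sn _ n) aQ).
Qed.

(** * Deterministic channels attain the upper bounds *)

Section Deterministic.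
Variable H0 : 'M[C]_(nr, nt).
Hypothesis HH0 : {ae P, forall w, H w = H0}.

(** Rank-one covariances along nearly optimal unit vectors bring the received power arbitrarily
    close to [spec2 H0]. *)
Lemma E2_le_lam_det : E2 <= lam.
Proof.
have E2H0 : E2 <= spec2 H0.
  have [N [mN N0 HN]] := HH0.
  (* A measurable function that dominates [spec2 (H w)] at every [w] and equals [spec2 H0] off the
     null set [N]. *)
  pose g w := spec2 H0 + frob2 (H w) * \1_N w.
  have mF := integ_meas iF.
  have mg : measurable_fun setT g.
    apply: measurable_funD; first exact: measurable_cst.
    by apply: measurable_funM => //; exact: measurable_indic.
  have g0 w : spec2 H0 <= g w <= spec2 H0 + frob2 (H w).
    rewrite /g lerDl lerD2l; rewrite indicE; case: (w \in N) => /=.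
      by rewrite mulr1 frob2_ge0 lexx.
    by rewrite mulr0 lexx frob2_ge0.
  have ig : integ P g.
    apply: (integ_le mg (integD (integ_cst P (spec2 H0)) iF)) => w.
    have /andP[h1 h2] := g0 w; rewrite ger0_norm//.
    exact: le_trans (spec2_ge0 H0) h1.
  have gE : EE P g = spec2 H0.
    apply: EE_ae_cst => //; exists N; split=> // w /= hw; apply: contrapT => wN.
    by apply: hw; rewrite /g indicE memNset//= mulr0 addr0.
  rewrite -gE -lee_fin -e2_fin -(integ_EFin ig).
  apply: ge0_le_integral_nomeas => w; rewrite lee_fin; first exact: spec2_ge0.
  have [wN|wN] := pselect (N w).
    rewrite /g indicE mem_set//= mulr1; apply: (le_trans (spec2_le_frob2 _ nt0)).
    by rewrite lerDr spec2_ge0.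
  rewrite /g indicE memNset//= mulr0 addr0.
  suff -> : H w = H0 by [].
  by apply: contrapT => h; apply: wN; exact: HN.
apply: (le_trans E2H0); apply/ler_addgt0Pr => e e0.
have [Q [aQ hQ]] := spec2_approx H0 nt0 e0.
have := wmean_le_lam aQ.
rewrite /wmean (@EE_ae_cst _ _ _ _ _ (wtr H0 Q)) ?lerBlDr; last 2 first.
- exact: integ_wtr aQ.1.
- by apply: filterS HH0 => w ->.
by move=> h; rewrite -lerBlDr; exact: le_trans (ltW hQ) h.
Qed.

(** Two constants that agree almost surely have equal expectations. *)
Lemma rankH0 : \rank H0 = M.
Proof.
apply/eqP; rewrite -(eqr_nat R); apply/eqP.
rewrite -[LHS](EE_cst P); apply: EE_ae_cst; first exact: integ_cst.
by apply: filterS2 HH0 rankH => w -> ->.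
Qed.

(** At [alpha = 1] the distortion is white for every admissible [Q], so equal power on the row space
    makes received signal and distortion proportional. *)
Lemma upoo_le_caplim_det : alpha = 1 -> upoo <= caplim.
Proof.
move=> a1; have rk := rankH0.
have r0 : (0 < \rank H0)%N by rewrite rk.
have [Q [aQ hQ]] := row_space_covariance r0.
have MR : 0 < M%:R :> R by rewrite ltr0n.
(* This is [(1 / M + y) / y] for the distortion level [y = kappa^2 / nt]. *)
set c := 1 + nt%:R / (M%:R * kappa ^+ 2).
have c1 : 1 <= c by rewrite lerDl divr_ge0// ?ler0n// mulr_ge0// ltW.
set y := kappa ^+ 2 / nt%:R; have y0 : 0 < y by rewrite divr_gt0.
have eY : Y Q = y%:C *: 1%:M by exact: Upsilon_alpha1.
have eQY s : gmi s H0 (Q + Y Q) = gmi s H0 ((c * y)%:C *: 1%:M).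
  have -> : c * y = M%:R^-1 + y by rewrite /c /y; field; rewrite !gt_eqF.
  by rewrite /gmi congrD hQ eY !congrZ !mulmx1 -scalerDl -rmorphD rk.
have [K0 hK] := gmi_scale_ge H0 y0 c1.
have lb n : (M%:R * ln c - K0 * n.+1%:R^-1) / ln 2 <= caplim.
  apply: le_trans (ler_supsup adm_neq0 mean_rate_le_upoo (ltr0Sn _ n) aQ).
  rewrite /mean_rate; apply: ler_wpM2r; first by rewrite invr_ge0 ltW.
  rewrite (@EE_ae_cst _ _ _ _ _ (gmi n.+1%:R H0 (Q + Y Q) - gmi n.+1%:R H0 (Y Q))).
  - by rewrite eQY eY -{1}rk; exact: hK.
  - exact: integ_diff.
  - by apply: filterS HH0 => w; rewrite /diff => ->.
have cv : (M%:R * ln c - K0 * n.+1%:R^-1) / ln 2 @[n --> \oo] --> upoo.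
  rewrite /upoo /log2 mulrA -/c; apply: cvgM; last exact: cvg_cst.
  rewrite -[X in _ --> X]subr0; apply: cvgB; first exact: cvg_cst.
  rewrite -[X in _ --> X](mulr0 K0); apply: cvgM; first exact: cvg_cst.
  exact: cvg_harmonic.
rewrite -(cvg_lim _ cv)//; apply: limr_le; first by apply: cvgP cv.
exact: nearW.
Qed.

End Deterministic.

(** * Right-rotationally invariant channels attain the lower bounds *)

Section RightRotationInvariant.
Hypothesis rot : right_rot_inv P H.

(** [H U] has the law of [H], and rotating the channel amounts to conjugating the covariance. *)
Lemma EE_gmi_rot s X U : 0 <= s -> psd X -> unitary U ->
  EE P (fun w => gmi s (H w) (U *m X *m hermT U)) = EE P (fun w => gmi s (H w) X).
Proof.
move=> s0 pX uU; pose phi (A : 'M[C]_(nr, nt)) := gmi s A X.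
have mphi := measurable_gmi (@mmeas_mxG R nr nt) s X.
have phi0 A : 0 <= phi A by exact: gmi_ge0.
have h := law_eq_EE (phi := phi) mH (mmeas_mul mH (mmeas_cst _ U)) (rot uU) mphi phi0.
have e : (fun w => phi (H w *m U)) = (fun w => gmi s (H w) (U *m X *m hermT U)).
  by apply/funext => w; exact: (gmi_mulr s (H w) U X).
by apply: esym; apply: (etrans h); exact: (congr1 (EE P) e).
Qed.

Lemma EE_wtr_rot X U : psd X -> unitary U ->
  EE P (fun w => wtr (H w) (U *m X *m hermT U)) = EE P (fun w => wtr (H w) X).
Proof.
move=> pX uU; pose phi (A : 'M[C]_(nr, nt)) := wtr A X.
have mphi := measurable_wtr (@mmeas_mxG R nr nt) X.
have phi0 A : 0 <= phi A by exact: wtr_ge0.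
have h := law_eq_EE (phi := phi) mH (mmeas_mul mH (mmeas_cst _ U)) (rot uU) mphi phi0.
have e : (fun w => phi (H w *m U)) = (fun w => wtr (H w) (U *m X *m hermT U)).
  by apply/funext => w; exact: (wtr_mulr (H w) U X).
by apply: esym; apply: (etrans h); exact: (congr1 (EE P) e).
Qed.

(** [wmean] is linear and invariant under conjugation, so averaging [Q] down to the isotropic
    covariance preserves its value. *)
Lemma lam_rot : lam = EF / nt%:R.
Proof.
apply/eqP; rewrite eq_le lam_ge andbT; apply: lam_le => Q aQ.
pose S Z := psd Z /\ wmean Z = wmean Q.
have Sc (t : R) A B : 0 <= t <= 1 -> S A -> S B -> S (t%:C *: A + (1 - t)%:C *: B).
  move=> /andP[t0 t1] [pA eA] [pB eB]; have t1' : 0 <= 1 - t by rewrite subr_ge0.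
  have p1 := psdZ t0 pA; have p2 := psdZ t1' pB; split; first exact: psdD.
  rewrite /wmean; under eq_fun do rewrite wtrD !wtrZ.
  rewrite EED; [|exact: integZ (integ_wtr pA)|exact: integZ (integ_wtr pB)].
  rewrite EEZ; last exact: integ_wtr.
  rewrite EEZ; last exact: integ_wtr.
  by move: eA eB; rewrite /wmean => -> ->; ring.
have Su U A : unitary U -> S A -> S (U *m A *m hermT U).
  move=> uU [pA eA]; split; first exact: psd_congr.
  by rewrite -eA; exact: EE_wtr_rot.
have [_ h] := S_trace nt0 Sc Su (conj aQ.1 (erefl (wmean Q)) : S Q).
by rewrite -h aQ.2 mulr1 wmean_isotropic.
Qed.

Lemma caplim_rot : caplim = lowoo.
Proof.
apply/eqP; rewrite eq_le lowoo_le_caplim andbT.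
suff h s Q : 0 < s -> adm Q -> mean_rate s Q <= lowoo by exact: (supsup_le adm_neq0 h).
move=> s0 aQ; have s0' := ltW s0.
set c := 1 + 1 / kappa ^+ 2.
have c1 : 1 <= c by rewrite lerDl divr_ge0// ltW.
have c0 : 0 <= c by exact: le_trans c1.
have pY := psd_Upsilon kappa0 alpha01 aQ; have pX := psdQY aQ.
have pcY := psdZ c0 pY.
pose Phi X := EE P (fun w => gmi s (H w) X).
(* Once [Q + Y Q] is replaced by [c] times [Y Q], [gmi_scale_le] bounds the difference by
   [M ln c]. *)
suff key : Phi (Q + Y Q) <= Phi (c%:C *: Y Q).
  rewrite /mean_rate /lowoo /log2 mulrA; apply: ler_wpM2r; first by rewrite invr_ge0 ltW.
  rewrite /diff EEB; [|exact: integ_gmi|exact: integ_gmi].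
  apply: (@le_trans _ _ (Phi (c%:C *: Y Q) - Phi (Y Q))); first by rewrite lerD2r.
  rewrite -EEB; [|exact: integ_gmi|exact: integ_gmi].
  rewrite -(EE_cst P (M%:R * _)); apply: EE_le => [||w]; [|exact: integ_cst|].
    by apply: integB; exact: integ_gmi.
  apply: (le_trans (gmi_scale_le (H w) pY s0' c1)).
  rewrite ler_wpM2r ?ln_ge0// ler_nat leq_min.
  by rewrite rank_leq_col rank_leq_row.
(* A superlevel set of [Phi]: convex by concavity, stable under conjugation by invariance of the
   law. *)
pose S Z := psd Z /\ Phi (Q + Y Q) <= Phi Z.
have Sc (t : R) A B : 0 <= t <= 1 -> S A -> S B -> S (t%:C *: A + (1 - t)%:C *: B).
  move=> t01 [pA eA] [pB eB]; have /andP[t0 t1] := t01.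
  have t1' : 0 <= 1 - t by rewrite subr_ge0.
  have pAB := psdD (psdZ t0 pA) (psdZ t1' pB); split; first exact: pAB.
  apply: (@le_trans _ _ (t * Phi A + (1 - t) * Phi B)).
    have -> : Phi (Q + Y Q) = t * Phi (Q + Y Q) + (1 - t) * Phi (Q + Y Q) by ring.
    exact: (lerD (ler_wpM2l t0 eA) (ler_wpM2l t1' eB)).
  apply: (EE_convex (integ_gmi s0' pA) (integ_gmi s0' pB) (integ_gmi s0' pAB)) => w.
  exact: gmi_concave.
have Su U A : unitary U -> S A -> S (U *m A *m hermT U).
  move=> uU [pA eA]; split; first exact: psd_congr.
  have aux (x y z : R) : x <= y -> z = y -> x <= z by move=> ? ->.
  exact: (aux _ _ _ eA (EE_gmi_rot s0' pA uU)).
have SX : S (Q + Y Q) by split.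
have S1 := S_diag Sc Su SX; have S2 := S_trace nt0 Sc Su SX.
have /andP[a0 a1] := alpha01.
have D0 : 0 < 1 + kappa ^+ 2 * (1 - alpha).
  by rewrite ltr_pwDl// mulr_ge0 ?(ltW k2)// subr_ge0.
(* The weight that matches the coefficient of [Q k k] in the mean of the diagonal and trace averages
   with that in [c] times [Y Q]; the constant terms then agree because the traces do. *)
set t := (1 + kappa ^+ 2) * (1 - alpha) / (1 + kappa ^+ 2 * (1 - alpha)).
have t01 : 0 <= t <= 1.
  apply/andP; split.
    apply: divr_ge0; last exact: ltW.
    by rewrite mulr_ge0 ?subr_ge0// addr_ge0// ltW.
  by rewrite ler_pdivrMr// mul1r mulrDl mul1r lerD2r lerBlDr lerDl.
have [_] := Sc t _ _ t01 S1 S2; congr (_ <= Phi _).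
have Qr k : Q k k = (re (Q k k))%:C.
  exact: (herm_diag_real _ aQ.1.1).
have trX : \tr (Q + Y Q) = (1 + kappa ^+ 2)%:C.
  rewrite linearD /= aQ.2 rmorphD; congr (_ + _).
  by rewrite -(re_tr_Upsilon kappa alpha nt0 aQ) UpsilonE tr_rdiag.
have uE := ups_admissible kappa alpha.
apply/matrixP => i j; rewrite trX UpsilonE !mxE.
have [->|ij] := eqVneq i j; last by rewrite !mulr0n !mulr0 addr0.
rewrite eqxx !mulr1n mulr1 {1}Qr -rmorphD -!rmorphM -rmorphD; congr (_%:C).
rewrite uE// /t /c; field.
by rewrite !gt_eqF.
Qed.

End RightRotationInvariant.

End System.

(** * Consequences of the channel assumptions *)

Section ChannelOk.
Variable R : realType.
Local Notation C := R[i].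
Variables (d : measure_display) (T : measurableType d) (P : probability T R).
Variables (nr nt : nat) (H : T -> 'M[C]_(nr, nt)).
Hypothesis okH : channel_ok P H.

Lemma channel_ok_mmeas : mmeas H.
Proof. by have [h1 h2 _ _] := okH => i j; split; [exact: h1 | exact: h2]. Qed.

Lemma channel_ok_rank : {ae P, forall w, \rank (H w) = minn nt nr}.
Proof. by have [] := okH. Qed.

Lemma channel_ok_integral :
  (\int[P]_w (frob2 (H w))%:E)%E = (nt * nr)%:R%:E.
Proof.
have [_ _ <- _] := okH; apply: eq_integral => w _; congr EFin.
by rewrite mxtrace_mulC tr_mul_hermT.
Qed.

Lemma channel_ok_integ : integ P (fun w => frob2 (H w)).
Proof.
apply/integrableP; split.
  by apply/measurable_EFinP; exact: (measurable_frob2 channel_ok_mmeas).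
under eq_integral do rewrite /= ger0_norm ?frob2_ge0//.
by rewrite channel_ok_integral ltry.
Qed.

Lemma channel_ok_EE : EE P (fun w => frob2 (H w)) = (nt * nr)%:R.
Proof. by rewrite /EE /Rintegral channel_ok_integral. Qed.

End ChannelOk.

(** * The single-antenna reference system *)

Section SingleAntenna.
Variable R : realType.
Local Notation C := R[i].
Variables (d : measure_display) (T : measurableType d) (P : probability T R).
Variables (h : T -> 'M[C]_(1, 1)) (kappa alpha : R).
Hypothesis kappa0 : 0 < kappa.
Hypothesis alpha01 : 0 <= alpha <= 1.
Hypothesis okh : channel_ok P h.

Let mh := channel_ok_mmeas okh.
Let ih := channel_ok_integ okh.
Let rh := channel_ok_rank okh.

(** With one transmit antenna the lower bound [EF / nt] is [EF], and the upper bound [E2] is at most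
    [EF]. *)
Lemma lam_single : lam P h = EE P (fun w => frob2 (h w)).
Proof.
apply/eqP; rewrite eq_le.
have -> : EE P (fun w => frob2 (h w)) <= lam P h.
  by have := lam_ge (ltn0Sn 0) mh ih; rewrite divr1.
rewrite andbT; apply: (le_trans (lam_le_E2 (ltn0Sn 0) mh ih)).
exact: E2_le_EF.
Qed.

(** At [nt = nr = 1] the bounds [lowoo] and [upoo] coincide. *)
Lemma caplim_single : caplim P h kappa alpha = log2 (1 + 1 / kappa ^+ 2).
Proof.
apply/eqP; rewrite eq_le; apply/andP; split.
  have := caplim_le_upoo (ltn0Sn 0) (ltn0Sn 0) kappa0 alpha01 mh ih rh.
  by rewrite /upoo minnn !mul1r.
have := lowoo_le_caplim (ltn0Sn 0) (ltn0Sn 0) kappa0 alpha01 mh ih rh.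
by rewrite /lowoo minnn -[X in _ -> X <= _]mul1r.
Qed.

End SingleAntenna.

Lemma ln2_gt0 (R : realType) : 0 < ln 2 :> R.
Proof. by rewrite ln_gt0// ltr1n. Qed.

(** * Limits of the multiplexing gain *)

Unset Implicit Arguments.
Local Close Scope complex_scope.
Local Open Scope classical_set_scope.
Local Open Scope ring_scope.

Theorem theorem2 (R : realType) (Nt Nr : nat)
    (d : measure_display) (T : measurableType d) (P : probability T R)
    (H : T -> 'M[R[i]]_(Nr, Nt))
    (d1 : measure_display) (T1 : measurableType d1) (P1 : probability T1 R)
    (h : T1 -> 'M[R[i]]_(1, 1))
    (kappa alpha : R) :
  (0 < Nt)%N -> (0 < Nr)%N -> 0 < kappa -> 0 <= alpha <= 1 ->
  channel_ok P H -> channel_ok P1 h ->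
  let Mg := fun snr : R => mux_gain P H P1 h kappa alpha snr in
  let M := minn Nt Nr in
  let EF := fine (expect P H (@frob2 R Nr Nt)) in
  let E2 := fine (expect P H (@spec2 R Nr Nt)) in
  let Eh := fine (expect P1 h (@frob2 R 1 1)) in
  let low0 := EF / (Nt%:R * Eh) in
  let up0 := E2 / Eh in
  let upoo := M%:R * log2 (1 + Nt%:R / (M%:R * kappa ^+ 2))
                   / log2 (1 + 1 / kappa ^+ 2) in
  exists l0 loo : R,
    (Mg x @[x --> 0^'+] --> l0) /\
    (Mg x @[x --> +oo] --> loo) /\
    (low0 <= l0 <= up0) /\
    (M%:R <= loo <= upoo) /\
    (deterministic P H /\ alpha = 1 -> l0 = up0 /\ loo = upoo) /\
    (right_rot_inv P H -> l0 = low0 /\ loo = M%:R).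
Proof.
move=> nt0 nr0 k0 a01 okH okh.
have mH := channel_ok_mmeas okH; have iH := channel_ok_integ okH.
have rH := channel_ok_rank okH.
have mh := channel_ok_mmeas okh; have ih := channel_ok_integ okh.
have rh := channel_ok_rank okh.
have n1 : (0 < 1)%N by [].
move=> Mg M EF E2 Eh low0 up0 upinf.
(* The energy normalization [Nt Nr] is 1 for a single antenna pair. *)
have Eh1 : Eh = 1 by exact: (channel_ok_EE okh).
have lam1 : lam P1 h = Eh := lam_single okh.
have c1 := caplim_single k0 a01 okh.
set L := log2 (1 + 1 / kappa ^+ 2) in upinf c1 *.
have l2 := ln2_gt0 R.
have L0 : 0 < L.
  rewrite /L /log2 divr_gt0// ln_gt0// ltrDl divr_gt0//.
  exact: exprn_gt0.
have MgE s : 0 < s -> Mg s = cap P H kappa alpha s / cap P1 h kappa alpha s.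
  move=> s0; rewrite /Mg /mux_gain (capacityE nt0 k0 a01 mH iH s0).
  by rewrite (capacityE n1 k0 a01 mh ih s0).
exists (lam P H / Eh), (caplim P H kappa alpha / L).
split; last split; last split; last split; last split.
- have cv1 := cvg_cap_slope nt0 k0 a01 mH iH.
  have cv2 := cvg_cap_slope n1 k0 a01 mh ih.
  have nz : lam P1 h / ln 2 != 0 by rewrite lam1 Eh1 gt_eqF// divr_gt0.
  (* The gain is the quotient of the two capacity slopes, in which [s] and [ln 2] cancel. *)
  have -> : lam P H / Eh = lam P H / ln 2 * (lam P1 h / ln 2)^-1.
    by rewrite lam1; field; rewrite Eh1 oner_eq0 gt_eqF.
  apply: cvg_trans (cvgM cv1 (cvgV nz cv2)); apply: near_eq_cvg; near=> s.
  have s0 : 0 < s by near: s; exact: nbhs_right_gt.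
  rewrite MgE//= invf_div mulrA divfK ?gt_eqF//.
- have cv1 := cvg_cap nt0 nr0 k0 a01 mH iH rH.
  have cv2 := cvg_cap n1 n1 k0 a01 mh ih rh.
  rewrite c1 in cv2; have nz : L != 0 by rewrite gt_eqF.
  apply: cvg_trans (cvgM cv1 (cvgV nz cv2)); apply: near_eq_cvg; near=> s.
  have s0 : 0 < s by near: s; apply: nbhs_pinfty_gt; exact: num_real.
  by rewrite MgE.
- apply/andP; split.
    rewrite /low0 invfM mulrA ler_pM2r ?invr_gt0 ?Eh1//.
    exact: (lam_ge nt0 mH iH).
  rewrite /up0 ler_pM2r ?invr_gt0 ?Eh1//.
  exact: (lam_le_E2 nt0 mH iH).
- apply/andP; split.
    rewrite ler_pdivlMr//.
    exact: (lowoo_le_caplim nt0 nr0 k0 a01 mH iH rH).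
  rewrite /upinf ler_pM2r ?invr_gt0//.
  exact: (caplim_le_upoo nt0 nr0 k0 a01 mH iH rH).
- move=> [[H0 HH0] a1]; split.
    rewrite /up0; congr (_ / _); apply/eqP; rewrite eq_le.
    rewrite (lam_le_E2 nt0 mH iH) /=.
    exact: (E2_le_lam_det nt0 mH iH HH0).
  rewrite /upinf; congr (_ / _); apply/eqP; rewrite eq_le.
  rewrite (caplim_le_upoo nt0 nr0 k0 a01 mH iH rH) /=.
  exact: (upoo_le_caplim_det nt0 nr0 k0 a01 mH iH rH HH0 a1).
- move=> rot; split.
    by rewrite /low0 (lam_rot nt0 mH iH rot) invfM mulrA.
  rewrite (caplim_rot nt0 nr0 k0 a01 mH iH rH rot) /lowoo mulfK// gt_eqF//.
Unshelve. all: by end_near.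
Qed.
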